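(* Let $|\psi\rangle\in\mathcal{H}_A\otimes\mathcal{H}_B\otimes\mathcal{H}_C$ be a uniformly random pure stabilizer state of $n=n_A+n_B+n_C$ qubits, let $\rho=\mathrm{tr}_C(|\psi\rangle\langle\psi|)$ and $n_{AB}=n_A+n_B$. In the thermodynamic limit, to leading order: (i) if $n_C>n_{AB}$, then $\mathbb{E}_{\mathrm S}[\mathcal{E}(\rho)]=\mathbb{E}_{\mathrm S}[\tilde{\mathcal{E}}_3(\rho)]\simeq0$; (ii) if $n_C<n_{AB}$ and both $n_A<n/2$ and $n_B<n/2$, then $\mathbb{E}_{\mathrm S}[\mathcal{E}(\rho)]=\mathbb{E}_{\mathrm S}[\tilde{\mathcal{E}}_3(\rho)]\simeq\frac12(n_{AB}-n_C)\ln2$; (iii) if $n_C<n_{AB}$ and either $n_A>n/2$ or $n_B>n/2$, then $\mathbb{E}_{\mathrm S}[\mathcal{E}(\rho)]=\mathbb{E}_{\mathrm S}[\tilde{\mathcal{E}}_3(\rho)]\simeq\min(n_A,n_B)\ln2$.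
   Context: Pure stabilizer states are the states obtained from $|0\rangle^{\otimes n}$ by Clifford unitaries (generated by Hadamard, $S$ and CNOT gates); $\mathbb{E}_{\mathrm S}$ is the uniform average over pure stabilizer states of $n$ qubits. Subsystem $X\in\{A,B,C\}$ consists of $n_X$ qubits. Thermodynamic limit: $n\to\infty$ with the fractions $n_X/n$ fixed (in the open regions of the stated inequalities); $\simeq$ denotes equality of the leading order in $n$, i.e. up to $o(n)$. The partial transpose on $B$ is $(X_A\otimes Y_B)^\Gamma=X_A\otimes Y_B^T$; $\mathcal{E}(\rho)=\ln\|\rho^\Gamma\|_1$; $p_\alpha=\mathrm{tr}((\rho^\Gamma)^\alpha)$; $\tilde{\mathcal{E}}_3(\rho)=\frac12\ln(p_2^2/p_3)$. *)

(* Defs.v *)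
From HB Require Import structures.
From mathcomp Require Import all_boot all_order all_algebra finmap.
From mathcomp Require Import all_classical all_reals all_analysis.
From mathcomp Require Import complex.

Set Implicit Arguments.
Unset Strict Implicit.
Unset Printing Implicit Defensive.

Import Order.TTheory GRing.Theory Num.Theory.
Import numFieldNormedType.Exports.

Local Open Scope ring_scope.
Local Open Scope classical_set_scope.
Local Open Scope sesquilinear_scope.

(* A register of qubits is a finite type Q of qubit labels.  Its computational
   basis is {ffun Q -> bool}; the matrix row/column of the basis vector x has
   index enum_rank x. *)
Definition cbasis (Q : finType) : finType := {ffun Q -> bool}.

Section Register.
Variables (R : realType) (Q : finType).

Definition op : Type := 'M[R[i]]_#|cbasis Q|.
Definition ket : Type := 'cV[R[i]]_#|cbasis Q|.

(* <x| X |y> *)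
Definition entry (X : op) (x y : cbasis Q) : R[i] :=
  X (enum_rank x) (enum_rank y).

Definition mkop (f : cbasis Q -> cbasis Q -> R[i]) : op :=
  \matrix_(i, j) f (enum_val i) (enum_val j).

Definition ket0 : ket := delta_mx (enum_rank ([ffun=> false] : cbasis Q)) 0.

Definition projector (v : ket) : op := v *m v ^t*.

(* The 2 x 2 matrix g acting on qubit q, tensored with the identity on all the
   other qubits. *)
Definition one_qubit_gate (g : bool -> bool -> R[i]) (q : Q) : op :=
  mkop (fun x y => if [forall r, (r != q) ==> (x r == y r)]
                   then g (x q) (y q) else 0).

Definition hadamard : Q -> op :=
  one_qubit_gate (fun a b => (-1) ^+ (a && b) / sqrtC 2%:R).

Definition phase_gate : Q -> op :=
  one_qubit_gate (fun a b => if a == b then (if a then 'i%C else 1) else 0).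

Definition cnot_map (c t : Q) (y : cbasis Q) : cbasis Q :=
  [ffun r => if r == t then y t (+) y c else y r].

(* control c, target t; a gate only when c != t *)
Definition cnot (c t : Q) : op :=
  mkop (fun x y => if x == cnot_map c t y then 1 else 0).

(* Inverses need no constructor: the generators have finite order. *)
Inductive clifford : op -> Prop :=
| clifford_id : clifford 1%:M
| clifford_hadamard (q : Q) : clifford (hadamard q)
| clifford_phase (q : Q) : clifford (phase_gate q)
| clifford_cnot (c t : Q) : c != t -> clifford (cnot c t)
| clifford_mul (U V : op) : clifford U -> clifford V -> clifford (U *m V).

(* Pure states are identified with their rank-one projectors |psi><psi|, i.e.
   vectors are taken up to a global phase. *)
Definition stabilizer_states : set op :=
  [set P | exists2 U, clifford U & P = projector (U *m ket0)].

(* stabilizer_states is finite, so fset_set enumerates it. *)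
Definition stabilizer_average (f : op -> R) : R :=
  (\sum_(P <- fset_set stabilizer_states) f P)
    / (#|` fset_set stabilizer_states|)%:R.

(* tr (sqrt (X^* X)): the spectrum of the Hermitian matrix X^* X is real and
   nonnegative. *)
Definition trace_norm (X : op) : R :=
  \sum_i Num.sqrt (complex.Re (spectral_diag (X ^t* *m X) 0 i)).

End Register.

Section Bipartite.
Variables (R : realType) (A B : finType).

(* The basis vector that agrees with x on A and with y on B. *)
Definition splice (x y : cbasis (A + B)%type) : cbasis (A + B)%type :=
  [ffun q => match q with inl _ => x q | inr _ => y q end].

Definition join (x : cbasis A) (z : cbasis B) : cbasis (A + B)%type :=
  [ffun q => match q with inl a => x a | inr b => z b end].

(* trace over B *)
Definition partial_trace (X : op R (A + B)%type) : op R A :=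
  mkop (fun x y => \sum_(z : cbasis B) entry X (join x z) (join y z)).

(* transposition on B:  <a b| X^Gamma |a' b'> = <a b'| X |a' b> *)
Definition partial_transpose (X : op R (A + B)%type) : op R (A + B)%type :=
  mkop (fun x y => entry X (splice x y) (splice y x)).

Definition log_negativity (rho : op R (A + B)%type) : R :=
  ln (trace_norm (partial_transpose rho)).

(* tr ((rho^Gamma)^alpha), a real number as rho^Gamma is Hermitian *)
Definition pt_moment (alpha : nat) (rho : op R (A + B)%type) : R :=
  complex.Re (\tr (partial_transpose rho ^+ alpha)).

Definition negativity3 (rho : op R (A + B)%type) : R :=
  ln (pt_moment 2 rho ^+ 2 / pt_moment 3 rho) / 2%:R.

End Bipartite.

Definition qubitsABC (nA nB nC : nat) : finType := ('I_nA + 'I_nB + 'I_nC)%type.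

Definition average_log_negativity (R : realType) (nA nB nC : nat) : R :=
  stabilizer_average (fun P : op R (qubitsABC nA nB nC) =>
    log_negativity (partial_trace P)).

Definition average_negativity3 (R : realType) (nA nB nC : nat) : R :=
  stabilizer_average (fun P : op R (qubitsABC nA nB nC) =>
    negativity3 (partial_trace P)).

(* f = g up to o(n) *)
Definition leading_order_eq (R : realType) (n : nat -> nat) (f g : nat -> R) :=
  (fun k => (f k - g k) / (n k)%:R) @ \oo --> (0 : R).

(* Main.v *)
From HB Require Import structures.
Require Import Defs.
From mathcomp Require Import all_boot all_order all_algebra finmap.
From mathcomp Require Import all_classical all_reals all_analysis.
From mathcomp Require Import complex.
From mathcomp Require Import zify ring lra.

(* For a pure stabilizer state P let S be the group of Paulis commuting with P,
   modulo phases: a Lagrangian subgroup of the symplectic space F_2^(2n).  Then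
   P = 2^-n sum_(v in S) (signed Pauli v), so that rho^Gamma is a sum over the
   subgroup G of elements of S supported on AB, of operators that multiply as
   signed Paulis twisted by the sign (-1)^(omega_A(u, v)).  With Z the radical of
   omega_A on G this yields (rho^Gamma)^3 = c rho^Gamma and
   E(rho) = E~_3(rho) = ln (|G| / |Z|) / 2 for every stabilizer state.

   Duality S = S^perp determines |G| up to the factor |S_C|, and bounds |Z| by the
   number of Paulis w with w_AB and w_AC in S.  The ensemble of groups S is
   invariant under all symplectic transvections, which act transitively on
   nonzero vectors and on pairs of distinct nonzero commuting vectors; so the
   averages of |S_X| for 2|X| <= n and (when all parties are below n/2) of |Z| are
   O(1).  As 0 <= ln x <= x for x >= 1, the averaged negativity is
   within O(1) of the claimed value. *)

Set Implicit Arguments.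
Unset Strict Implicit.
Unset Printing Implicit Defensive.

Import Order.TTheory GRing.Theory Num.Theory.
Import numFieldNormedType.Exports.

Local Open Scope ring_scope.
Local Open Scope sesquilinear_scope.

(** * The symplectic space of Paulis *)

(** What shapes case (iii) is that |Z| is not O(1) there: if n_A > n/2 it is at least 2^(n_A - n_B -
    n_C). Only the ratio |G| / |Z| is controlled, and it is squeezed between 4^n_B / |S_BC|^2 and
    4^n_B (with A and B exchanged if n_B > n/2). The upper end holds because an element of G that is
    trivial on one party lies in Z; the lower end comes from the triple count together with duality.
    In case (i) the bounds 1 <= |Z| <= |G| suffice, since |G| itself averages to O(1). Membership
    statistics of at most two Paulis are enough for all averages. A fixed nonzero Pauli lies in a
    fraction at most 2^-n of the groups, a commuting pair of distinct nonzero Paulis in a fraction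
    at most 4 / 4^n. Hence the constants: for 2|X| <= n the zero Pauli contributes 1 to the mean of
    |S_X| and the others at most 4^|X| / 2^n <= 1, so 2 in total; the mean of the triple count is at
    most 2 + 2 + 2 + 4. *)

Definition pauli (Q : finType) := {ffun Q -> bool * bool}.

Section SymplecticForm.
Variable Q : finType.
Implicit Types (u v w : pauli Q) (X Y : {set Q}).

Definition site_form (a b : bool * bool) : bool :=
  (a.1 && b.2) (+) (a.2 && b.1).

Definition symp u v : bool := \big[addb/false]_q site_form (u q) (v q).

Lemma pauliDD u : u + u = 0.
Proof. by apply/ffunP=> q; rewrite !ffunE; case: (u q) => [[] []]. Qed.

Lemma pauliN u : - u = u.
Proof. by apply/eqP; rewrite eq_sym -subr_eq0 opprK pauliDD. Qed.

Lemma pauliDK v : involutive (fun u => u + v).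
Proof. by move=> u; rewrite -addrA pauliDD addr0. Qed.

Lemma pauliD_eq0 u v : (u + v == 0) = (u == v).
Proof. by rewrite -{1}[v]pauliN subr_eq0. Qed.

Lemma sympC u v : symp u v = symp v u.
Proof.
by apply: eq_bigr => q _; rewrite /site_form; case: (u q) (v q) => [[] []] [[] []].
Qed.

Lemma sympDl u v w : symp (u + v) w = symp u w (+) symp v w.
Proof.
rewrite /symp -big_split; apply: eq_bigr => q _; rewrite ffunE /site_form /=.
by case: (u q) (v q) (w q) => [[] []] [[] []] [[] []].
Qed.

Lemma sympDr u v w : symp u (v + w) = symp u v (+) symp u w.
Proof. by rewrite sympC sympDl !(sympC u). Qed.

Lemma symp0l u : symp 0 u = false.
Proof. by apply: big1 => q _; rewrite ffunE. Qed.

Lemma symp0r u : symp u 0 = false.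
Proof. by rewrite sympC symp0l. Qed.

Lemma symp_self u : symp u u = false.
Proof. by apply: big1 => q _; rewrite /site_form; case: (u q) => [[] []]. Qed.

Definition restrict X u : pauli Q := [ffun q => if q \in X then u q else 0].

Definition supported X : {set pauli Q} := [set u | restrict X u == u].

Lemma restrictD X u v : restrict X (u + v) = restrict X u + restrict X v.
Proof. by apply/ffunP=> q; rewrite !ffunE; case: ifP; rewrite ?addr0. Qed.

Lemma restrict0 X : restrict X 0 = 0.
Proof. by apply/ffunP=> q; rewrite !ffunE if_same. Qed.

Lemma restrictI X Y u : restrict X (restrict Y u) = restrict (X :&: Y) u.
Proof. by apply/ffunP=> q; rewrite !ffunE inE; case: (q \in X). Qed.

Lemma restrict_supported X u : restrict X u \in supported X.
Proof. by rewrite inE restrictI finset.setIid. Qed.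

Lemma restrict_setC X u : restrict X u + restrict (~: X) u = u.
Proof. by apply/ffunP=> q; rewrite !ffunE inE; case: ifP; rewrite ?addr0 ?add0r. Qed.

Lemma supported_setC X u : (u \in supported (~: X)) = (restrict X u == 0).
Proof.
rewrite inE -pauliD_eq0 addrC; congr (_ == 0).
by have := congr1 (+%R^~ (restrict (~: X) u)) (restrict_setC X u); rewrite /= pauliDK.
Qed.

Lemma card_supported X : #|supported X| = (4 ^ #|X|)%N.
Proof.
have -> : 4%N = #|predT : pred (bool * bool)%type| by rewrite (eq_card (B := {: bool * bool})) // card_prod !card_bool.
rewrite -(card_pffun_on (0 : bool * bool) X); apply: eq_card => u.
rewrite inE; apply/eqP/pffun_onP => [<-|[/fintype.subsetP suppu _]].
  by split=> //; apply/fintype.subsetP => q; rewrite inE ffunE; case: ifP => // _ /negP[].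
apply/ffunP => q; rewrite ffunE; case: ifPn => // qX.
by apply/esym/eqP; apply: contraNT qX => /suppu.
Qed.

Lemma card_pauli : #|pauli Q| = (4 ^ #|Q|)%N.
Proof. by rewrite card_ffun card_prod card_bool. Qed.

Lemma symp_restrictl X u v : symp (restrict X u) v = symp u (restrict X v).
Proof.
apply: eq_bigr => q _; rewrite !ffunE; case: ifP => // _.
by rewrite /site_form /= !andbF.
Qed.

Definition at_site (q : Q) (a : bool * bool) : pauli Q :=
  [ffun r => if r == q then a else 0].

Lemma symp_at_site q a u : symp (at_site q a) u = site_form a (u q).
Proof.
rewrite /symp (bigD1 q) //= big1 ?addbF ?ffunE ?eqxx // => r /negPf rq.
by rewrite ffunE rq.
Qed.

Lemma symp_nondegenerate u : u != 0 -> exists v, symp u v.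
Proof.
move=> u0; have [q uq] : exists q, u q != 0.
  apply/existsP; apply: contraNT u0 => /existsPn u0; apply/eqP/ffunP => q.
  by rewrite ffunE; apply/eqP/negPn.
(* A single-site Pauli that anticommutes with [u q]: X if [u q] has a Z part, and Z otherwise. *)
exists (at_site q ((u q).2, (u q).1 && ~~ (u q).2)); rewrite sympC symp_at_site /site_form.
by case: (u q) uq => [[] []].
Qed.

Definition subgroup (H : {set pauli Q}) :=
  0 \in H /\ {in H &, forall u v, u + v \in H}.

Lemma subgroup_supported X : subgroup (supported X).
Proof.
split; first by rewrite inE restrict0.
by move=> u v; rewrite !inE restrictD => /eqP-> /eqP->.
Qed.

Lemma subgroupI H K : subgroup H -> subgroup K -> subgroup (H :&: K).
Proof.
move=> [H0 HD] [K0 KD]; split; first by rewrite inE H0.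
by move=> u v /setIP[uH uK] /setIP[vH vK]; rewrite inE HD // KD.
Qed.

Lemma subgroupDr H u v : subgroup H -> v \in H -> (u + v \in H) = (u \in H).
Proof.
move=> [_ HD] vH; apply/idP/idP => [uvH|uH]; last exact: HD.
by rewrite -[u](pauliDK v) HD.
Qed.

(** Orthogonality of characters: if [f] is true at some [h0] of [H], translation by [h0] permutes
    [H] and negates every term, so the sum equals its own opposite. *)
Lemma character_sum (K : numDomainType) H (f : pauli Q -> bool) :
    subgroup H -> {in H &, {morph f : u v / u + v >-> u (+) v}} ->
  \sum_(h in H) (-1) ^+ f h = (if [forall h in H, ~~ f h] then #|H|%:R else 0 : K).
Proof.
move=> sH fD; case: ifPn => [/forall_inP f0|/forall_inPn[h0 h0H /negPn fh0]].
  rewrite -sum1_card natr_sum; apply: eq_bigr => h hH.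
  by rewrite (negPf (f0 h hH)).
set s := (LHS); suff : s = - s.
  by move/eqP; rewrite -addr_eq0 -mulr2n mulrn_eq0 => /eqP.
rewrite {1}/s (reindex_inj (inv_inj (pauliDK h0))) /= -sumrN.
apply: eq_big => h; first by rewrite subgroupDr.
by rewrite subgroupDr // => hH; rewrite fD // fh0 addbT signrN.
Qed.

Lemma symp_sum (K : numDomainType) H v : subgroup H ->
  \sum_(h in H) (-1) ^+ symp h v =
    (if [forall h in H, ~~ symp h v] then #|H|%:R else 0 : K).
Proof. by move=> sH; apply: character_sum => // u w _ _ /=; rewrite sympDl. Qed.

Lemma forall_symp_supported X v :
  [forall h in supported X, ~~ symp h v] = (restrict X v == 0).
Proof.
apply/forall_inP/eqP => [Xv|Xv h]; last first.
  by rewrite inE => /eqP <-; rewrite symp_restrictl Xv symp0r.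
apply/eqP/negPn/negP => /symp_nondegenerate[w].
rewrite symp_restrictl sympC.
by apply/negP/Xv/restrict_supported.
Qed.

Lemma symp_sum_supported (K : numDomainType) X v :
  \sum_(h in supported X) (-1) ^+ symp h v =
    (if restrict X v == 0 then (4 ^ #|X|)%:R else 0 : K).
Proof.
by rewrite symp_sum ?forall_symp_supported ?card_supported //; apply: subgroup_supported.
Qed.

Lemma symp_sumT (K : numDomainType) v :
  \sum_h (-1) ^+ symp h v = (if v == 0 then (4 ^ #|Q|)%:R else 0 : K).
Proof.
have restrictT u : restrict [set: Q] u = u by apply/ffunP=> q; rewrite ffunE inE.
rewrite -cardsT -[v in RHS]restrictT -symp_sum_supported; apply: eq_bigl => h.
by rewrite inE restrictT eqxx.
Qed.

Definition lagrangian (S : {set pauli Q}) :=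
  [/\ subgroup S, #|S| = (2 ^ #|Q|)%N &
      forall v, (v \in S) = [forall s in S, ~~ symp s v]].

(** Summing the signs [(-1) ^+ symp s v] over all [v] and all [s] in [S] in both orders gives
    |S^perp| |S| = 4^|Q|. With |S| = 2^|Q|, the inclusion of [S] in its orthogonal must be an
    equality. *)
Lemma isotropic_lagrangian S : subgroup S -> #|S| = (2 ^ #|Q|)%N ->
  {in S &, forall u v, ~~ symp u v} -> lagrangian S.
Proof.
move=> sS cS iS; split=> //.
pose S' := [set v | [forall s in S, ~~ symp s v]].
suff /eqP SS' : S == S' by move=> v; rewrite {1}SS' inE.
rewrite eqEcard; apply/andP; split.
  by apply/fintype.subsetP => v vS; rewrite inE; apply/forall_inP => s sS'; apply: iS.
have : (\sum_v \sum_(s in S) (-1) ^+ symp s v : int) = (4 ^ #|Q|)%:R.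
  rewrite exchange_big /= (bigD1 (0 : pauli Q)) /=; last by case: sS.
  rewrite [X in _ + X]big1 => [|s /andP[_ /negPf s0]]; last first.
    under eq_bigr do rewrite sympC.
    by rewrite symp_sumT s0.
  by under eq_bigr do rewrite sympC; rewrite symp_sumT eqxx addr0.
under eq_bigr do rewrite symp_sum //.
rewrite -big_mkcond sumr_const /= => /eqP.
rewrite -mulrnA eqr_nat -[4%N]/(2 * 2)%N expnMn -cS => /eqP e.
have -> : #|S'| = #|[pred v | [forall s in S, ~~ symp s v]]| by apply: eq_card=> v; rewrite !inE.
have : (0 < #|S|)%N by rewrite cS expn_gt0.
by move=> S0; rewrite -(leq_pmul2l S0) e.
Qed.

End SymplecticForm.

(** * Regions and the radical of the restricted form *)

Lemma card_le_fibers (I J : finType) (D : {set I}) (E : {set J}) (f : I -> J) k :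
    {in D, forall d, f d \in E} ->
    {in D, forall d, (#|[set d' in D | f d' == f d]| <= k)%N} ->
  (#|D| <= #|E| * k)%N.
Proof.
move=> fE fk; rewrite -sum1_card (partition_big f (mem E)) //= -sum_nat_const.
apply: leq_sum => e eE; rewrite sum1_card.
have [/existsP[d /andP[dD /eqP fd]]|/existsPn e0] := boolP [exists d, (d \in D) && (f d == e)].
  rewrite -fd; apply: leq_trans (fk _ dD); apply: subset_leq_card.
  by apply/fintype.subsetP => x; rewrite !inE.
by rewrite eq_card0 // => x; apply/negbTE/e0.
Qed.

(** The fibre of [f] through [d] lies in the translate d + K. This form of the first isomorphism
    theorem, as an inequality, gives the size comparisons between local groups, triples and
    radical. *)
Lemma card_le_cosets (Q : finType) (J : finType) (D K : {set pauli Q}) (E : {set J})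
    (f : pauli Q -> J) :
    {in D, forall d, f d \in E} ->
    {in D &, forall d d', f d = f d' -> d + d' \in K} ->
  (#|D| <= #|E| * #|K|)%N.
Proof.
move=> fE fK; apply: (card_le_fibers fE) => d dD.
rewrite -(card_imset _ (inv_inj (pauliDK d))); apply: subset_leq_card.
by apply/fintype.subsetP => _ /imsetP[d' + ->]; rewrite inE => /andP[d'D /eqP /fK]; apply.
Qed.

Lemma sum_if_const (I : finType) (V : nmodType) (A : {set I}) (p : pred I) (c : V) :
  \sum_(i in A) (if p i then c else 0) = c *+ #|[set i in A | p i]|.
Proof.
by rewrite -big_mkcondr sumr_const; congr (_ *+ _); apply: eq_card => i; rewrite !inE.
Qed.

Section Regions.
Variables (Q : finType) (S : {set pauli Q}).
Hypothesis lagS : lagrangian S.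
Implicit Types (A B C X : {set Q}) (u v w : pauli Q).

Definition local X := S :&: supported X.

Let subS : subgroup S. Proof. by case: lagS. Qed.

Lemma subgroup_local X : subgroup (local X).
Proof. by apply: subgroupI => //; apply: subgroup_supported. Qed.

Lemma symp_lagrangian : {in S &, forall u v, symp u v = false}.
Proof.
case: lagS => _ _ Sperp u v uS; rewrite Sperp => /forall_inP/(_ u uS).
by move/negPf.
Qed.

Lemma symp_sum_lagrangian (K : numDomainType) v :
  \sum_(s in S) (-1) ^+ symp s v = (if v \in S then (2 ^ #|Q|)%:R else 0 : K).
Proof. by case: lagS => sS <- ->; rewrite symp_sum. Qed.

(** Complementary regions of a pure state have equal entropy, here |X| ln 2 - ln |S_X|. The proof
    counts signs over [supported X] times [S] in both orders: one order leaves the elements of [S]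
    supported in [X], the other those vanishing on [X]. *)
Lemma card_local_setC X :
  (#|local (~: X)| * 4 ^ #|X| = 2 ^ #|Q| * #|local X|)%N.
Proof.
have e : \sum_(w in supported X) \sum_(s in S) (-1) ^+ symp s w =
          \sum_(s in S) \sum_(w in supported X) (-1) ^+ symp w s :> int.
  by rewrite exchange_big; do 2!(apply: eq_bigr => ? _); rewrite sympC.
move: e; under eq_bigr do rewrite symp_sum_lagrangian.
under [in X in _ = X -> _]eq_bigr do rewrite symp_sum_supported.
rewrite !sum_if_const -!mulrnA => /eqP; rewrite eqr_nat => /eqP e.
have -> : local (~: X) = [set s in S | restrict X s == 0].
  by apply/setP => v; rewrite !inE -supported_setC inE.
by rewrite mulnC -e; congr (_ * #|pred_of_set _|)%N; apply/setP => v; rewrite !inE andbC.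
Qed.

Lemma local_gt0 X : (0 < #|local X|)%N.
Proof. by apply/card_gt0P; exists 0; case: (subgroup_local X). Qed.

Definition radical A B :=
  [set g in local (A :|: B) |
    [forall h in local (A :|: B), ~~ symp (restrict A g) h]].

(** For a tripartition the two restrictions add up to [restrict (B :|: C) w], so [w] packages three
    stabilizers on AB, AC and BC with sum zero, as ZZZ does for a GHZ state. The condition is
    symmetric in the three regions, unlike the formula. *)
Definition triples A B C :=
  [set w | (restrict (A :|: B) w \in S) && (restrict (A :|: C) w \in S)].

Definition tripartition A B C :=
  forall q, ((q \in A) + (q \in B) + (q \in C) == 1)%N.

Lemma tripartition_swap A B C : tripartition A B C -> tripartition B A C.
Proof. by move=> p q; rewrite (addnC (q \in B : nat)). Qed.

Lemma tripartition_rot A B C : tripartition A B C -> tripartition B C A.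
Proof. by move=> p q; rewrite -(eqP (p q)) addnC addnA. Qed.

Lemma tripartition_setC A B C : tripartition A B C -> A :|: B = ~: C.
Proof.
move=> p; apply/setP => q; rewrite !inE.
by move: (p q); case: (q \in A) (q \in B) (q \in C) => [] [] [].
Qed.

Lemma card_tripartition A B C : tripartition A B C -> (#|A| + #|B| + #|C| = #|Q|)%N.
Proof.
move=> p; have cardE X : #|X| = (\sum_q (q \in X))%N.
  by rewrite -sum1_card big_mkcond; apply: eq_bigr => q _; case: (q \in X).
rewrite !cardE -!big_split -sum1_card; apply: eq_bigr => q _; exact/eqP/p.
Qed.

Lemma triples_swap A B C : tripartition A B C -> triples A B C = triples B A C.
Proof.
move=> p; apply/setP => w; rewrite !inE (finset.setUC B A); apply: andb_id2l => ABw.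
rewrite -(subgroupDr _ subS ABw); congr (_ \in S); apply/ffunP => q.
rewrite !ffunE !inE; move: (p q).
by case: (q \in A) (q \in B) (q \in C) (w q) => [] [] [] [[] []].
Qed.

Section Tripartition.
Variables A B C : {set Q}.
Hypothesis p3 : tripartition A B C.

(* Elements of the radical are, on A, orthogonal to S_AB, hence agree on A with
   an element of S supported on A and C: this uses (S_AB)^perp = S + V_C. *)
Lemma radical_completion g : g \in radical A B ->
  exists2 c, c \in supported C & restrict A g + c \in S.
Proof.
rewrite inE => /andP[gG /forall_inP gperp]; apply/exists_inP.
apply: contraT => /exists_inPn noc.
(* If no completion exists, the left side vanishes term by term. On the right only the [s] that
   vanish on [C] survive, and these pair trivially with [restrict A g]; so all terms are nonnegative
   and [s] = 0 contributes a positive one. *)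
have e : \sum_(c in supported C) \sum_(s in S) (-1) ^+ symp s (restrict A g + c) =
    \sum_(s in S) (-1) ^+ symp s (restrict A g) *
       \sum_(c in supported C) (-1) ^+ symp c s :> int.
  rewrite exchange_big; apply: eq_bigr => s _; rewrite mulr_sumr.
  by apply: eq_bigr => c _; rewrite sympDr signr_addb (sympC s c).
move: e; rewrite big1 => [|c cC]; last by rewrite symp_sum_lagrangian (negPf (noc c cC)).
under eq_bigr do rewrite symp_sum_supported.
rewrite (bigD1 (0 : pauli Q)) /=; last by case: subS.
rewrite symp0l restrict0 eqxx mul1r => /esym/eqP; rewrite gt_eqF //.
apply: ltr_pwDl; first by rewrite ltr0n expn_gt0.
apply: sumr_ge0 => s /andP[sS _]; case: ifPn => [sC|]; last by rewrite mulr0.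
rewrite -(sympC (restrict A g)) (negPf (gperp s _)) ?mul1r ?ler0n //.
by rewrite inE sS (tripartition_setC p3) supported_setC.
Qed.

(** If [c] completes [g] as in [radical_completion], then [g + c] is in [triples] and restricts to
    [g] on AB; so the radical is contained in the image of [triples] under restriction. *)
Lemma radical_le_triples : (#|radical A B| <= #|triples A B C|)%N.
Proof.
apply: leq_trans (leq_imset_card (restrict (A :|: B)) _).
apply/subset_leq_card/fintype.subsetP => g gZ; have [c cC gcS] := radical_completion gZ.
move: gZ; rewrite inE => /andP[+ _]; rewrite 2!inE => /andP[gS /eqP gAB].
move: cC; rewrite inE => /eqP cC.
apply/imsetP; exists (g + c); last first.
  rewrite restrictD gAB -cC restrictI; apply/ffunP => q.
  rewrite !ffunE !inE; move: (p3 q).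
  by case: (q \in A) (q \in B) (q \in C) (g q) => [] [] [] //= [[] []].
rewrite inE; apply/andP; split.
  suff -> : restrict (A :|: B) (g + c) = g by [].
  rewrite restrictD gAB -cC restrictI; apply/ffunP => q.
  rewrite !ffunE !inE; move: (p3 q).
  by case: (q \in A) (q \in B) (q \in C) (g q) => [] [] [] //= [[] []].
suff -> : restrict (A :|: C) (g + c) = restrict A g + c by [].
rewrite -gAB -cC !restrictD !restrictI; apply/ffunP => q.
rewrite !ffunE !inE; move: (p3 q).
by case: (q \in A) (q \in B) (q \in C) (g q) (c q) => [] [] [] //= [[] []] [[] []].
Qed.

(** Send [w] to its restriction to BC, which is a sum of two elements of [S]. Two triples with the
    same image differ by a Pauli supported on [A], which equals its own restriction to AB and hence
    lies in [S]. *)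
Lemma card_triples_le : (#|triples A B C| <= #|local A| * #|local (B :|: C)|)%N.
Proof.
rewrite mulnC; apply: (card_le_cosets (f := restrict (B :|: C))) => [w|w w'].
  rewrite !inE => /andP[wAB wAC]; rewrite restrictI finset.setIid eqxx andbT.
  rewrite -(subgroupDr _ subS wAB) -(subgroupDr _ subS wAC).
  suff -> : restrict (B :|: C) w + restrict (A :|: B) w + restrict (A :|: C) w = 0.
    by case: subS.
  apply/ffunP => q; rewrite !ffunE !inE; move: (p3 q).
  by case: (q \in A) (q \in B) (q \in C) (w q) => [] [] [] //= [[] []].
rewrite !inE => /andP[wAB wAC] /andP[wAB' _] ww'.
have e : restrict (A :|: B) (w + w') = w + w' /\ restrict A (w + w') = w + w'.
  have {}ww' q : q \notin A -> w q = w' q.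
    move=> /negPf qA; move/ffunP: ww' => /(_ q); rewrite !ffunE !inE; move: (p3 q).
    by rewrite qA; case: (q \in B) (q \in C) => [] [].
  split; apply/ffunP => q; rewrite !ffunE ?inE; case: (boolP (q \in A)) => //= qA.
    by rewrite (ww' q qA); case: ifP => // _; case: (w' q) => [[] []].
  by rewrite (ww' q qA); case: (w' q) => [[] []].
case: e => <- {1}->; rewrite eqxx andbT restrictD.
by case: subS => _; apply.
Qed.

(** Elements of S_AB that agree on [A] differ by one that is trivial on [A], and this is visibly in
    the radical of the form on [A]. *)
Lemma card_local_le_radical_l : (#|local (A :|: B)| <= 4 ^ #|A| * #|radical A B|)%N.
Proof.
rewrite -card_supported; apply: (card_le_cosets (f := restrict A)) => [w _|w w'].
  exact: restrict_supported.
move=> wG w'G /eqP; rewrite -pauliD_eq0 -restrictD => /eqP Aww'; rewrite inE Aww'.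
have [_ -> //=] := subgroup_local (A :|: B).
by apply/forall_inP => h _; rewrite symp0l.
Qed.

(** An element of S_AB that is trivial on [B] is supported on [A], so its form on [A] is the full
    symplectic form, which vanishes on [S]. *)
Lemma card_local_le_radical_r : (#|local (A :|: B)| <= 4 ^ #|B| * #|radical A B|)%N.
Proof.
rewrite -card_supported; apply: (card_le_cosets (f := restrict B)) => [w _|w w'].
  exact: restrict_supported.
move=> wG w'G /eqP; rewrite -pauliD_eq0 -restrictD => /eqP Bww'; rewrite inE.
have ww'G : w + w' \in local (A :|: B) by have [_ ->] := subgroup_local (A :|: B).
rewrite ww'G; apply/forall_inP => h; rewrite inE => /andP[hS _].
suff -> : restrict A (w + w') = w + w'.
  by rewrite symp_lagrangian //; move: ww'G; rewrite inE => /andP[].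
move: ww'G; rewrite 2!inE => /andP[_ /eqP] e; move/ffunP: Bww' => Bww'.
rewrite -[RHS]e; apply/ffunP => q; rewrite !ffunE inE.
case: (boolP (q \in A)) => //= qA; case: ifP => // qB.
by have := Bww' q; rewrite !ffunE qB.
Qed.

Lemma radical_sub : radical A B \subset local (A :|: B).
Proof. by apply/fintype.subsetP => g; rewrite inE => /andP[]. Qed.

Lemma radical0 : 0 \in radical A B.
Proof.
rewrite inE restrict0; have [-> _ /=] := subgroup_local (A :|: B).
by apply/forall_inP => h _; rewrite symp0l.
Qed.

Lemma radical_gt0 : (0 < #|radical A B|)%N.
Proof. by apply/card_gt0P; exists 0; apply: radical0. Qed.

End Tripartition.
End Regions.

(** * Transvections *)

Section CliffordMoves.
Variable Q : finType.
Implicit Types (u v w : pauli Q) (q c t : Q) (a b : bool * bool).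

Definition set_site w q a : pauli Q := [ffun r => if r == q then a else w r].

Definition hadamard_move q v : pauli Q := set_site v q ((v q).2, (v q).1).

Definition phase_move q v : pauli Q := set_site v q ((v q).1, (v q).2 (+) (v q).1).

Definition cnot_move c t v : pauli Q :=
  set_site (set_site v c ((v c).1, (v c).2 (+) (v t).2))
           t ((v t).1 (+) (v c).1, (v t).2).

Definition transvection w v := v + (if symp w v then w else 0).

(** Modulo phases even the gate S, of order four, acts as an involution, since its square Z only
    changes signs of Paulis. Conjugation by a move thus needs no separate inverse. *)
Definition symplectic_involution (phi : pauli Q -> pauli Q) :=
  [/\ {morph phi : u v / u + v}, involutive phi &
      forall u v, symp (phi u) (phi v) = symp u v].

Lemma symp_set_site u v q a b : symp (set_site u q a) (set_site v q b) =
  site_form a b (+) (site_form (u q) (v q) (+) symp u v).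
Proof.
rewrite /symp [in LHS](bigD1 q) // [in RHS](bigD1 q) //= !ffunE eqxx addKb.
by congr (_ (+) _); apply: eq_bigr => r /negPf rq; rewrite !ffunE rq.
Qed.

Lemma hadamard_move_symplectic q : symplectic_involution (hadamard_move q).
Proof.
split=> [u v|v|u v].
- by apply/ffunP => r; rewrite !ffunE; case: eqVneq => [_|//]; case: (u q) (v q).
- by apply/ffunP => r; rewrite !ffunE eqxx; case: eqVneq => [->|//]; case: (v q).
rewrite symp_set_site addbA; case: (symp u v).
  by case: (u q) (v q) => [[] []] [[] []].
by case: (u q) (v q) => [[] []] [[] []].
Qed.

Lemma phase_move_symplectic q : symplectic_involution (phase_move q).
Proof.
split=> [u v|v|u v].
- apply/ffunP => r; rewrite !ffunE; case: eqVneq => [_|//].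
  by case: (u q) (v q) => [[] []] [[] []].
- by apply/ffunP => r; rewrite !ffunE eqxx; case: eqVneq => [->|//]; case: (v q) => [[] []].
rewrite symp_set_site addbA; case: (symp u v).
  by case: (u q) (v q) => [[] []] [[] []].
by case: (u q) (v q) => [[] []] [[] []].
Qed.

Lemma cnot_move_symplectic c t : c != t -> symplectic_involution (cnot_move c t).
Proof.
move=> ct; have tc : (t == c) = false by rewrite eq_sym (negPf ct).
split=> [u v|v|u v].
- apply/ffunP => r; rewrite !ffunE; case: eqVneq => [_|_].
    by case: (u c) (v c) (u t) (v t) => [[] []] [[] []] [[] []] [[] []].
  by case: eqVneq => // _; case: (u c) (v c) (u t) (v t) => [[] []] [[] []] [[] []] [[] []].
- apply/ffunP => r; rewrite !ffunE !eqxx (negPf ct) /=; case: eqVneq => [->|_].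
    by case: (v c) (v t) => [[] []] [[] []].
  by case: eqVneq => [->|//]; case: (v c) (v t) => [[] []] [[] []].
rewrite !symp_set_site !ffunE tc; case: (symp u v).
  by case: (u c) (v c) (u t) (v t) => [[] []] [[] []] [[] []] [[] []].
by case: (u c) (v c) (u t) (v t) => [[] []] [[] []] [[] []] [[] []].
Qed.

Lemma transvectionK w : involutive (transvection w).
Proof.
move=> v; rewrite /transvection sympDr.
case e: (symp w v); rewrite ?symp_self ?symp0r addbF ?e ?addr0 //.
by rewrite -addrA pauliDD addr0.
Qed.

Lemma symp_transvection w u v : symp (transvection w u) (transvection w v) = symp u v.
Proof.
rewrite /transvection sympDl !sympDr.
by case eu: (symp w u); case ev: (symp w v);
  rewrite ?symp_self ?symp0r ?symp0l ?ev ?(sympC u w) ?eu; case: (symp u v).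
Qed.

Lemma transvection0 w : transvection w 0 = 0.
Proof. by rewrite /transvection symp0r addr0. Qed.

Lemma transvection_move u v : symp u v -> transvection (u + v) u = v.
Proof.
by move=> uv; rewrite /transvection sympDl symp_self sympC uv /= addrA pauliDD add0r.
Qed.

Lemma transvection_fix w u : symp w u = false -> transvection w u = u.
Proof. by move=> wu; rewrite /transvection wu addr0. Qed.

Definition invariant (f : pauli Q -> pauli Q -> nat) phi :=
  forall u v, f (phi u) (phi v) = f u v.

Section Generation.
Variable f : pauli Q -> pauli Q -> nat.
Hypothesis inv_h : forall q, invariant f (hadamard_move q).
Hypothesis inv_s : forall q, invariant f (phase_move q).
Hypothesis inv_cx : forall c t, c != t -> invariant f (cnot_move c t).

(** A transvection is built from its vector and the form alone, so an isometry [phi] carries the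
    transvection along [w] to the one along [phi w]. *)
Lemma transvection_conj w phi : symplectic_involution phi -> invariant f phi ->
  invariant f (transvection (phi w)) -> invariant f (transvection w).
Proof.
move=> [phiD phiK phi_symp] f_phi f_t u v.
have phi0 : phi 0 = 0 by rewrite -(pauliDD u) phiD !pauliDD.
have conj x : phi (transvection w x) = transvection (phi w) (phi x).
  by rewrite /transvection phi_symp phiD; case: ifP; rewrite ?phi0.
by rewrite -f_phi !conj f_t f_phi.
Qed.

Lemma set_site_id w q : set_site w q (w q) = w.
Proof. by apply/ffunP => r; rewrite ffunE; case: eqVneq => [->|]. Qed.

(** The nonzero letter of [w] at [q] can be taken to be Z: the phase move turns Y into X, and the
    Hadamard move turns X into Z, without touching other sites. *)
Lemma transvection_site w q a : a != 0 ->
  invariant f (transvection (set_site w q (false, true))) ->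
  invariant f (transvection (set_site w q a)).
Proof.
move=> a0 fz.
have fx : invariant f (transvection (set_site w q (true, false))).
  apply: transvection_conj (hadamard_move_symplectic q) (inv_h q) _.
  suff -> : hadamard_move q (set_site w q (true, false)) = set_site w q (false, true) by [].
  by apply/ffunP => r; rewrite !ffunE eqxx; case: eqVneq.
case: a a0 => [[] []] //= _.
apply: transvection_conj (phase_move_symplectic q) (inv_s q) _.
suff -> : phase_move q (set_site w q (true, true)) = set_site w q (true, false) by [].
by apply/ffunP => r; rewrite !ffunE eqxx; case: eqVneq.
Qed.

(* Conjugating by Clifford moves reduces the weight of w down to a single Z,
   whose transvection is the phase gate. *)
Lemma transvection_invariant w : invariant f (transvection w).
Proof.
have [n] := ubnP #|[set q | w q != 0]|; elim: n w => // n IHn w wn.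
have [q wq|w0] := pickP (fun q => w q != 0); last first.
  have -> : w = 0 by apply/ffunP => q; rewrite ffunE; apply/eqP/negPn; rewrite w0.
  by move=> u v; rewrite !transvection_fix ?symp0l.
rewrite -(set_site_id w q); apply: transvection_site => //.
have [t /andP[tq wt]|wt0] := pickP (fun t => (t != q) && (w t != 0)); last first.
  suff e : transvection (set_site w q (false, true)) =1 phase_move q.
    by move=> u v; rewrite !e inv_s.
  move=> v; have -> : set_site w q (false, true) = at_site q (false, true).
    apply/ffunP => r; rewrite !ffunE; case: eqVneq => // rq; apply/eqP.
    by have := wt0 r; rewrite rq /= => /negPn.
  rewrite /transvection symp_at_site /site_form /=; apply/ffunP => r.
  case vq: (v q).1; rewrite !ffunE; case: eqVneq => [->|_]; rewrite ?addr0 //.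
    by case: (v q) vq => [[] []].
  by case: (v q) vq => [[] []].
rewrite -(set_site_id (set_site w q _) t) ffunE (negPf tq).
apply: transvection_site => //.
have qt : q != t by rewrite eq_sym.
(* With Z at both [q] and [t], a CNOT with control [q] and target [t] adds the Z part at [t] to the
   one at [q]. Site [q] becomes trivial and the weight drops by one. *)
apply: transvection_conj (cnot_move_symplectic qt) (inv_cx qt) _.
apply: IHn; rewrite -ltnS; apply: leq_trans wn; rewrite ltnS.
apply: proper_card; apply/fintype.properP; split; last first.
  by exists q; rewrite ?inE // !ffunE eqxx (negPf qt) /= eqxx.
apply/fintype.subsetP => r; rewrite !inE !ffunE (negPf qt) (negPf tq) !eqxx.
case: (eqVneq r t) => [->|rt]; first by rewrite wt.
by case: (eqVneq r q) => [->|rq].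
Qed.

End Generation.
End CliffordMoves.

(** * Averages over transvection-invariant ensembles *)

Section Transitivity.
Variable Q : finType.
Implicit Types (u v w : pauli Q).

Definition commuting_pair u v := [&& u != 0, v != 0, v != u & ~~ symp u v].

(** The product (1 + s_u)(1 - s_v)(1 - s_w) of characters is nonzero exactly at the wanted [z]. In
    its sum over all [z] the negative terms belong to v, w, u + v and u + w, all nonzero by
    hypothesis, so they drop out and the constant term keeps the sum positive. The case [u] = 0 is
    allowed and used. *)
Lemma symp_separation u v w : v != 0 -> w != 0 -> v != u -> w != u ->
  exists z, [&& ~~ symp z u, symp z v & symp z w].
Proof.
move=> v0 w0 vu wu; apply/existsP; apply: contraT => /existsPn noz.
pose s (x z : pauli Q) : int := (-1) ^+ symp z x.
have sD x y z : s x z * s y z = s (x + y) z by rewrite /s sympDr signr_addb.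
have : \sum_z (1 + s u z) * (1 - s v z) * (1 - s w z) = 0.
  apply: big1 => z _; have := noz z; rewrite /s.
  by case: (symp z u) (symp z v) (symp z w) => [] [] [].
have e z : (1 + s u z) * (1 - s v z) * (1 - s w z) =
    1 + s u z - s v z - s w z - s (u + v) z - s (u + w) z + s (v + w) z + s (u + v + w) z.
  by rewrite -!sD; ring.
under eq_bigr do rewrite e.
rewrite !big_split /= !sumrN /s !symp_sumT sumr_const card_pauli.
rewrite !pauliD_eq0 (negPf v0) (negPf w0) (eq_sym u v) (negPf vu) (eq_sym u w) (negPf wu).
have : (0 < 4 ^ #|Q|)%N by rewrite expn_gt0.
move: (4 ^ #|Q|)%N => N N0.
by case: (u == 0); case: (v == w); case: (u + v == w); lia.
Qed.

Variable f : pauli Q -> pauli Q -> nat.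
Hypothesis inv_t : forall w, invariant f (transvection w).

(** If [u] and [u'] anticommute, the transvection along u + u' sends one to the other; otherwise
    pass through a [z] that anticommutes with both. *)
Lemma move_fst u v u' : u' != 0 -> commuting_pair u v ->
  exists2 v', commuting_pair u' v' & f u v = f u' v'.
Proof.
have step u1 v1 u2 : symp u1 u2 -> commuting_pair u1 v1 ->
    exists2 v2, commuting_pair u2 v2 & f u1 v1 = f u2 v2.
  move=> u12 /and4P[u10 v10 v1u1 s1].
  pose T := transvection (u1 + u2).
  have Tu1 : T u1 = u2 by apply: transvection_move.
  have Tinj : injective T := inv_inj (transvectionK _).
  exists (T v1); last by rewrite -Tu1 inv_t.
  rewrite /commuting_pair -Tu1 symp_transvection s1 (inj_eq Tinj) v1u1 andbT.
  by rewrite -(transvection0 (u1 + u2)) !(inj_eq Tinj) u10 v10.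
move=> u'0 uv; have u0 : u != 0 by case/and4P: uv.
have [z /and3P[_ zu zu']] : exists z, [&& ~~ symp z 0, symp z u & symp z u'].
  exact: symp_separation.
rewrite sympC in zu.
by have [w zw ->] := step _ _ _ zu uv; exact: step zu' zw.
Qed.

(** The transvection along v1 + v2 moves v1 to v2 when these anticommute, and fixes [u] because [u]
    commutes with both. The intermediate [z] must therefore also commute with [u]. *)
Lemma move_snd u v v' : commuting_pair u v -> commuting_pair u v' -> f u v = f u v'.
Proof.
have step v1 v2 : commuting_pair u v1 -> commuting_pair u v2 -> symp v1 v2 ->
    f u v1 = f u v2.
  move=> /and4P[u0 v10 v1u s1] /and4P[_ v20 v2u s2] v12.
  rewrite -(inv_t (v1 + v2) u v1) transvection_move // transvection_fix //.
  by rewrite sympDl !(sympC _ u) (negPf s1) (negPf s2).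
move=> uv uv'; case/and4P: (uv) => u0 v0 vu s; case/and4P: (uv') => _ v'0 v'u s'.
have [z /and3P[zu zv zv']] := symp_separation v0 v'0 vu v'u.
have z0 : z != 0 by apply: contraTneq zv => ->; rewrite symp0l.
have zneu : z != u by apply: contraTneq zv => ->; rewrite (negPf s).
have uz : commuting_pair u z by rewrite /commuting_pair u0 z0 zneu sympC.
by rewrite (step _ z) // 1?sympC // (step z v').
Qed.

Lemma pair_transitive u v u' v' :
  commuting_pair u v -> commuting_pair u' v' -> f u v = f u' v'.
Proof.
move=> uv uv'; have u'0 : u' != 0 by case/and4P: uv'.
by have [w uw ->] := move_fst u'0 uv; apply: move_snd.
Qed.

Lemma point_transitive u v : u != 0 -> v != 0 -> f u u = f v v.
Proof.
move=> u0 v0; have step x y : symp x y -> f x x = f y y.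
  by move=> xy; rewrite -(inv_t (x + y) x) !transvection_move.
have [z /and3P[_ zu zv]] : exists z, [&& ~~ symp z 0, symp z u & symp z v].
  exact: symp_separation.
by rewrite -(step _ _ zu); apply: step.
Qed.

End Transitivity.

Lemma sum_nat_const_seq (I : Type) (r : seq I) (c : nat) :
  (\sum_(i <- r) c = size r * c)%N.
Proof. by rewrite big_const_seq count_predT iter_addn_0 mulnC. Qed.

Section Averages.
Variables (Q : finType) (L : seq {set pauli Q}).
Hypothesis lagL : {in L, forall S, lagrangian S}.

(** [L] is a sequence rather than a set, since states that differ only in signs share a group and
    must be counted separately. The diagonal values are the one-point counts, so one invariance
    hypothesis covers both moments. *)
Definition pair_count (u v : pauli Q) : nat := \sum_(S <- L) ((u \in S) && (v \in S)).

Hypothesis inv_t : forall w, invariant pair_count (transvection w).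
Implicit Types (u v w : pauli Q) (X A B C : {set Q}).

Lemma sum_card_pair_count (D : {set pauli Q}) (g h : pauli Q -> pauli Q) :
  (\sum_(S <- L) #|[set w in D | (g w \in S) && (h w \in S)]| =
   \sum_(w in D) pair_count (g w) (h w))%N.
Proof.
rewrite exchange_big; apply: eq_bigr => S _.
rewrite -sum1_card (eq_bigl (fun w => (w \in D) && ((g w \in S) && (h w \in S)))); last first.
  by move=> w; rewrite inE.
by rewrite big_mkcondr; apply: eq_bigr => w _; case: (_ && _).
Qed.

Lemma pair_count00 : pair_count 0 0 = size L.
Proof.
rewrite /pair_count -sum1_size 2!big_seq; apply: eq_bigr => S /lagL[[S0 _] _ _].
by rewrite S0.
Qed.

Lemma expn4 n : (4 ^ n = 2 ^ n * 2 ^ n)%N.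
Proof. by rewrite -expnMn. Qed.

(** By transitivity the 2^n - 1 nonzero elements of each group are spread evenly over the 4^n - 1
    nonzero Paulis: the frequency is 1 / (2^n + 1). *)
Lemma point_count u : u != 0 -> (pair_count u u * 2 ^ #|Q| <= size L)%N.
Proof.
move=> u0.
have e : (\sum_(w in [set~ (0%R : pauli Q)]) pair_count w w = size L * (2 ^ #|Q| - 1))%N.
  rewrite -(sum_card_pair_count _ id id) -sum_nat_const_seq [RHS]big_seq [LHS]big_seq.
  apply: eq_bigr => S /lagL[[S0 _] cS _].
  rewrite -cS (cardsD1 (0 : pauli Q) S) S0 addKn; apply: eq_card => w.
  by rewrite !inE andbb.
have : (pair_count u u * (4 ^ #|Q| - 1) = size L * (2 ^ #|Q| - 1))%N.
  rewrite -e -card_pauli subn1 -(cardsC1 (0 : pauli Q)) mulnC -sum_nat_const.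
  by apply: eq_bigr => w; rewrite !inE => w0; apply: point_transitive.
have : (1 < 2 ^ #|Q|)%N.
  rewrite -{1}(expn0 2) ltn_exp2l // lt0n; apply: contraNneq u0 => Q0.
  by apply/eqP/ffunP => q; have := card0_eq Q0 q; rewrite inE.
rewrite expn4; move: (2 ^ _)%N (pair_count u u) (size L) => N p l.
case: N => [|[|N]] // _; rewrite subSS subn0.
have -> : (N.+2 * N.+2 - 1 = N.+3 * N.+1)%N by lia.
by rewrite mulnA => /eqP; rewrite eqn_pmul2r // => /eqP <-; lia.
Qed.

(** The zero Pauli accounts for one [size L]. The other 4^|X| - 1 Paulis on [X], each of frequency
    at most 2^-n, account for at most another one. *)
Lemma sum_local X : (#|X|.*2 <= #|Q|)%N ->
  (\sum_(S <- L) #|local S X| <= (size L).*2)%N.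
Proof.
move=> X2.
have -> : (\sum_(S <- L) #|local S X| = \sum_(w in supported X) pair_count w w)%N.
  rewrite -(sum_card_pair_count _ id id); apply: eq_bigr => S _.
  by apply: eq_card => w; rewrite !inE andbb andbC.
rewrite (bigD1 (0 : pauli Q)) /=; last by rewrite inE restrict0.
rewrite pair_count00 -addnn leq_add2l.
have N0 : (0 < 2 ^ #|Q|)%N by rewrite expn_gt0.
rewrite -(leq_pmul2r N0) big_distrl /=.
apply: (@leq_trans (\sum_(w in supported X) size L)).
  rewrite [leqRHS](bigD1 (0 : pauli Q)) /=; last by rewrite inE restrict0.
  apply: leq_trans (leq_addl _ _); apply: leq_sum => w /andP[_ w0].
  exact: point_count.
rewrite sum_nat_const card_supported mulnC leq_mul2l.
by rewrite -[4%N]/(2 ^ 2)%N -expnM mul2n leq_exp2l // X2 orbT.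
Qed.

Lemma card_commutant u : u != 0 ->
  (#|[set v : pauli Q | ~~ symp v u]| * 2 = 4 ^ #|Q|)%N.
Proof.
move=> u0; have := symp_sumT int u; rewrite (negPf u0) => e.
have : \sum_(v : pauli Q) (1 + (-1) ^+ symp v u) = (4 ^ #|Q|)%:R :> int.
  by rewrite big_split /= e addr0 sumr_const card_pauli.
rewrite (bigID (fun v => symp v u)) /= big1 => [|v ->]; last by rewrite subrr.
rewrite add0r (eq_bigr (fun=> 2)) => [|v /negPf->] //.
rewrite sumr_const -mulrnA => /eqP; rewrite eqr_nat mulnC => /eqP <-.
by congr (_ * _)%N; apply: eq_card => v; rewrite !inE.
Qed.

Definition commuting_pairs : {set pauli Q * pauli Q} :=
  [set p | commuting_pair p.1 p.2].

(** With N = 4^n, each of the N - 1 nonzero [u] has N/2 - 2 partners: half of all Paulis commute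
    with [u], and 0 and [u] are excluded. The product reaches N^2 / 4 once N >= 16, whence the two
    qubits. *)
Lemma card_commuting_pairs : (2 <= #|Q|)%N ->
  (4 ^ #|Q| * 4 ^ #|Q| <= 4 * #|commuting_pairs|)%N.
Proof.
move=> Q2.
have c u : u != 0 -> (4 ^ #|Q| <= 2 * #|[set v | commuting_pair u v]| + 4)%N.
  move=> u0; rewrite -(card_commutant u0).
  rewrite (cardsD1 (0 : pauli Q)) (cardsD1 u).
  have -> : #|([set v | ~~ symp v u] :\ (0%R : pauli Q)) :\ u| = #|[set v | commuting_pair u v]|.
    apply: eq_card => v; rewrite !inE /commuting_pair u0 /= (sympC u).
    by case: (v == u) (v == 0) => [] [].
  rewrite !inE symp0l symp_self u0 /=; lia.
have -> : #|commuting_pairs| = (\sum_(u | u != 0%R :> pauli Q) #|[set v | commuting_pair u v]|)%N.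
  rewrite -sum1_card (eq_bigl (fun p => (p.1 != 0) && commuting_pair p.1 p.2)); last first.
    by move=> [u v]; rewrite inE /= /commuting_pair; case: (u == 0).
  rewrite -(pair_big_dep (fun u : pauli Q => u != 0)
    (fun u v => commuting_pair u v) (fun _ _ => 1%N)) /=.
  by apply: eq_bigr => u u0; rewrite sum1_card; apply: eq_card => v; rewrite !inE.
have : (\sum_(u | u != 0%R :> pauli Q) 4 ^ #|Q| <=
   \sum_(u | u != 0%R :> pauli Q) (2 * #|[set v | commuting_pair u v]| + 4))%N.
  by apply: leq_sum => u /c.
rewrite big_split /= -big_distrr /= !sum_nat_const.
have -> : #|[pred u : pauli Q | u != 0]| = (4 ^ #|Q| - 1)%N.
  by rewrite -card_pauli subn1 -(cardC1 (0 : pauli Q)); apply: eq_card => u; rewrite !inE.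
have : (16 <= 4 ^ #|Q|)%N by rewrite -[16%N]/(4 ^ 2)%N leq_exp2l.
move: (4 ^ _)%N (\sum_(_ | _) _)%N => N s N16; nia.
Qed.

(** Each group contains at most (2^n)^2 = 4^n pairs, shared evenly by at least 4^(2n) / 4 commuting
    pairs. *)
Lemma pair_count_le u v : (2 <= #|Q|)%N -> commuting_pair u v ->
  (pair_count u v * 4 ^ #|Q| <= 4 * size L)%N.
Proof.
move=> Q2 uv.
have le : (#|commuting_pairs| * pair_count u v <= size L * 4 ^ #|Q|)%N.
  rewrite -sum_nat_const.
  rewrite (eq_bigr (fun p => pair_count p.1 p.2)) => [|[x y]]; last first.
    by rewrite inE => /= xy; apply: pair_transitive.
  apply: (@leq_trans (\sum_p pair_count p.1 p.2)).
    by rewrite [leqRHS](bigID (mem commuting_pairs)) leq_addr.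
  rewrite exchange_big -sum_nat_const_seq [leqRHS]big_seq [leqLHS]big_seq.
  apply: leq_sum => S /lagL[_ cS _]; rewrite expn4 -cS -cardsX -sum1_card.
  rewrite [leqRHS]big_mkcond; apply: leq_sum => [[x y]] _; rewrite !inE /=.
  by case: (_ && _).
have := card_commuting_pairs Q2.
have : (0 < 4 ^ #|Q|)%N by rewrite expn_gt0.
move: le; move: (4 ^ _)%N (pair_count _ _) (size L) #|_| => N p l c le N0 cN.
rewrite -(leq_pmul2r N0); nia.
Qed.

(** The two restrictions of [w] overlap only on [A], where they agree, so they commute. Either they
    form a [commuting_pair], counted for at most 4^n choices of [w] with frequency at most 4 / 4^n
    each; or one of them is zero or they coincide, and then [w] is itself in [S] and supported on a
    single party. *)
Lemma sum_triples A B C : (2 <= #|Q|)%N -> tripartition A B C ->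
  (\sum_(S <- L) #|triples S A B C| <=
    \sum_(S <- L) (#|local S A| + #|local S B| + #|local S C|) + 4 * size L)%N.
Proof.
move=> Q2 p3.
pose g := restrict (A :|: B); pose h := restrict (A :|: C).
pose D := [set w | commuting_pair (g w) (h w)].
have sumD : (\sum_(S <- L) #|[set w in D | (g w \in S) && (h w \in S)]| <= 4 * size L)%N.
  rewrite sum_card_pair_count.
  have N0 : (0 < 4 ^ #|Q|)%N by rewrite expn_gt0.
  rewrite -(leq_pmul2r N0) big_distrl /=.
  apply: (@leq_trans (\sum_(w in D) 4 * size L)).
    by apply: leq_sum => w; rewrite inE; apply: pair_count_le.
  by rewrite sum_nat_const mulnC leq_mul2l -card_pauli max_card orbT.
apply: leq_trans (leq_add (leqnn _) sumD); rewrite -big_split /=.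
apply: leq_sum => S _.
have : triples S A B C \subset local S A :|: local S B :|: local S C :|:
    [set w in D | (g w \in S) && (h w \in S)].
  apply/fintype.subsetP => w; rewrite !inE -/(g w) -/(h w) => /andP[gS hS].
  rewrite gS hS andbT /commuting_pair.
  have -> /= : symp (g w) (h w) = false.
    rewrite /symp big1 // => q _; rewrite !ffunE !inE; move: (p3 q).
    by case: (q \in A) (q \in B) (q \in C) (w q) => [] [] [] [[] []].
  case: (eqVneq (g w) 0) => [/ffunP g0|_] /=.
    have [ew eC] : h w = w /\ restrict C w = w.
      by split; apply/ffunP => q; move: (g0 q) (p3 q); rewrite /g /h !ffunE !finset.in_setU;
        case: (q \in A) (q \in B) (q \in C) => [] [] [].
    by rewrite eC (_ : w \in S) ?eqxx ?orbT // -ew.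
  case: (eqVneq (h w) 0) => [/ffunP h0|_] /=.
    have [ew eB] : g w = w /\ restrict B w = w.
      by split; apply/ffunP => q; move: (h0 q) (p3 q); rewrite /g /h !ffunE !finset.in_setU;
        case: (q \in A) (q \in B) (q \in C) => [] [] [].
    by rewrite eB (_ : w \in S) ?eqxx ?orbT // -ew.
  case: (eqVneq (h w) (g w)) => [/ffunP gh|_] /=; last by rewrite !orbT.
  have [ew eA] : g w = w /\ restrict A w = w.
    by split; apply/ffunP => q; move: (gh q) (p3 q); rewrite /g /h !ffunE !finset.in_setU;
      case: (q \in A) (q \in B) (q \in C) => [] [] [].
  by rewrite eA (_ : w \in S) ?eqxx ?orbT // -ew.
move/subset_leq_card/leq_trans; apply.
by do 3!(apply: leq_trans (leq_card_setU _ _) _; rewrite leq_add2r).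
Qed.

End Averages.

(** * Weyl operators *)

Section Entries.
Variables (R : realType) (Q : finType).
Implicit Types (X Y : op R Q) (s t : cbasis Q).

Lemma entry_mkop f s t : entry (mkop f : op R Q) s t = f s t.
Proof. by rewrite /entry mxE !enum_rankK. Qed.

Lemma op_ext X Y : (forall s t, entry X s t = entry Y s t) -> X = Y.
Proof.
by move=> XY; apply/matrixP => i j; have := XY (enum_val i) (enum_val j); rewrite /entry !enum_valK.
Qed.

Lemma sum_enum (F : 'I_#|cbasis Q| -> R[i]) : \sum_i F i = \sum_s F (enum_rank s).
Proof. by rewrite (reindex enum_rank) //; apply: onW_bij; apply: enum_rank_bij. Qed.

Lemma entry_mul X Y s t : entry (X *m Y) s t = \sum_r entry X s r * entry Y r t.
Proof. by rewrite /entry mxE sum_enum. Qed.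

Lemma entry_id s t : entry (1%:M : op R Q) s t = (s == t)%:R.
Proof. by rewrite /entry mxE (inj_eq enum_rank_inj). Qed.

Lemma entryZ a X s t : entry (a *: X) s t = a * entry X s t.
Proof. by rewrite /entry mxE. Qed.

Lemma entry_sum (I : finType) (p : pred I) (F : I -> op R Q) s t :
  entry (\sum_(i | p i) F i) s t = \sum_(i | p i) entry (F i) s t.
Proof. by rewrite /entry summxE. Qed.

Lemma trace_entry X : \tr X = \sum_s entry X s s.
Proof. by rewrite /mxtrace sum_enum. Qed.

Lemma entry_adj X s t : entry (X ^t* ) s t = (entry X t s)^*.
Proof. by rewrite /entry !mxE. Qed.

Lemma card_cbasis : #|cbasis Q| = (2 ^ #|Q|)%N.
Proof. by rewrite card_ffun card_bool. Qed.

End Entries.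

Section Weyl.
Variables (R : realType) (Q : finType).
Implicit Types (u v w : pauli Q) (s t : cbasis Q) (X : op R Q).

Definition flip v t : cbasis Q := [ffun q => t q (+) (v q).1].

Definition zdot v t : bool := \big[addb/false]_q ((v q).2 && t q).

Definition zxdot u v : bool := \big[addb/false]_q ((u q).2 && (v q).1).

(* X^x Z^z with v = (x, z), without the phase i^(x.z) that would make it Hermitian *)
Definition weyl v : op R Q :=
  mkop (fun s t => (s == flip v t)%:R * (-1) ^+ zdot v t).

Lemma flipK v : involutive (flip v).
Proof. by move=> t; apply/ffunP => q; rewrite !ffunE addbK. Qed.

Lemma flipD u v t : flip (u + v) t = flip u (flip v t).
Proof. by apply/ffunP => q; rewrite !ffunE; case: (t q) (u q) (v q) => [] [[] []] [[] []]. Qed.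

Lemma flip0 t : flip 0 t = t.
Proof. by apply/ffunP => q; rewrite !ffunE addbF. Qed.

Lemma flip_eq v s t : (s == flip v t) = (flip v s == t).
Proof. by rewrite -(inj_eq (inv_inj (flipK v))) flipK. Qed.

Lemma zdotD u v t : zdot (u + v) t = zdot u t (+) zdot v t.
Proof.
rewrite /zdot -big_split; apply: eq_bigr => q _; rewrite ffunE /=.
by case: (t q) (u q) (v q) => [] [[] []] [[] []].
Qed.

Lemma zdot_flip u v t : zdot u (flip v t) = zdot u t (+) zxdot u v.
Proof.
rewrite /zdot /zxdot -big_split; apply: eq_bigr => q _; rewrite ffunE /=.
by case: (t q) (u q) (v q) => [] [[] []] [[] []].
Qed.

Lemma zdot0 t : zdot 0 t = false.
Proof. by apply: big1 => q _; rewrite ffunE. Qed.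

Lemma zxdotDl u v w : zxdot (u + v) w = zxdot u w (+) zxdot v w.
Proof.
rewrite /zxdot -big_split; apply: eq_bigr => q _; rewrite ffunE /=.
by case: (u q) (v q) (w q) => [[] []] [[] []] [[] []].
Qed.

Lemma zxdotDr u v w : zxdot u (v + w) = zxdot u v (+) zxdot u w.
Proof.
rewrite /zxdot -big_split; apply: eq_bigr => q _; rewrite ffunE /=.
by case: (u q) (v q) (w q) => [[] []] [[] []] [[] []].
Qed.

Lemma symp_zxdot u v : symp u v = zxdot u v (+) zxdot v u.
Proof.
rewrite /symp /zxdot -big_split; apply: eq_bigr => q _; rewrite /site_form /=.
by case: (u q) (v q) => [[] []] [[] []].
Qed.

Lemma entry_weyl v s t : entry (weyl v) s t = (s == flip v t)%:R * (-1) ^+ zdot v t.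
Proof. by rewrite entry_mkop. Qed.

Lemma entry_weyl_mul v X s t :
  entry (weyl v *m X) s t = (-1) ^+ zdot v (flip v s) * entry X (flip v s) t.
Proof.
rewrite entry_mul (bigD1 (flip v s)) //= entry_weyl flipK eqxx mul1r big1 ?addr0 // => r.
by rewrite entry_weyl flip_eq eq_sym => /negPf ->; rewrite !mul0r.
Qed.

Lemma entry_mul_weyl v X s t :
  entry (X *m weyl v) s t = (-1) ^+ zdot v t * entry X s (flip v t).
Proof.
rewrite entry_mul (bigD1 (flip v t)) //= entry_weyl eqxx mul1r mulrC big1 ?addr0 // => r.
by rewrite entry_weyl => /negPf ->; rewrite mul0r mulr0.
Qed.

Lemma weyl0 : weyl 0 = 1%:M.
Proof. by apply: op_ext => s t; rewrite entry_weyl entry_id flip0 zdot0 mulr1. Qed.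

Lemma weylM u v : weyl u *m weyl v = (-1) ^+ zxdot u v *: weyl (u + v).
Proof.
apply: op_ext => s t; rewrite entry_mul_weyl entryZ !entry_weyl flipD zdotD zdot_flip.
rewrite !signr_addb; ring.
Qed.

Lemma weylC u v : weyl u *m weyl v = (-1) ^+ symp u v *: (weyl v *m weyl u).
Proof.
rewrite !weylM scalerA symp_zxdot -signr_addb (addrC v).
by rewrite -addbA addbb addbF.
Qed.

Lemma weyl_sq v : weyl v *m weyl v = (-1) ^+ zxdot v v *: 1%:M.
Proof. by rewrite weylM pauliDD weyl0. Qed.

Lemma weyl_adj v : (weyl v) ^t* = (-1) ^+ zxdot v v *: weyl v.
Proof.
apply: op_ext => s t; rewrite entry_adj entryZ !entry_weyl rmorphM rmorph_nat rmorph_sign.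
rewrite flip_eq eq_sym; case: eqVneq => [->|_]; last by rewrite !mul0r mulr0.
by rewrite !mul1r zdot_flip signr_addb mulrC.
Qed.

Lemma weyl_adjM v : weyl v *m (weyl v) ^t* = 1%:M.
Proof. by rewrite weyl_adj -scalemxAr weyl_sq scalerA -expr2 sqrr_sign scale1r. Qed.

(** For [v] nonzero, some [W w] anticommutes with [W v]; cyclicity of the trace then makes the trace
    equal to its opposite. *)
Lemma trace_weyl v : \tr (weyl v) = if v == 0 then (2 ^ #|Q|)%:R else 0.
Proof.
case: eqVneq => [->|/symp_nondegenerate[w]]; first by rewrite weyl0 mxtrace1 card_cbasis.
move=> vw; have : \tr (weyl v *m weyl w *m weyl w) = - \tr (weyl w *m weyl v *m weyl w).
  by rewrite weylC vw expr1 scaleN1r mulNmx raddfN.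
rewrite -[in RHS]mulmxA [in RHS]mxtrace_mulC -!mulmxA weyl_sq.
rewrite -!scalemxAr !mulmx1 mxtraceZ => /eqP.
by rewrite -addr_eq0 -mulr2n mulrn_eq0 /= mulf_eq0 signr_eq0 => /eqP.
Qed.

Lemma trace_weyl_adj_mul v X :
  \tr ((weyl v) ^t* *m X) = \sum_s (-1) ^+ zdot v s * entry X (flip v s) s.
Proof.
rewrite weyl_adj -scalemxAl mxtraceZ trace_entry mulr_sumr; apply: eq_bigr => s _.
rewrite entry_weyl_mul zdot_flip signr_addb.
by case: (zxdot v v); rewrite /= ?expr0 ?expr1; ring.
Qed.

Lemma card_flip (a b : cbasis Q) : #|[set v | a == flip v b]| = (2 ^ #|Q|)%N.
Proof.
rewrite -card_cbasis -cardsT.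
pose f (z : cbasis Q) : pauli Q := [ffun q => (a q (+) b q, z q)].
have f_inj : injective f.
  by move=> z z' /ffunP e; apply/ffunP => q; have := e q; rewrite !ffunE => -[].
rewrite -(card_imset _ f_inj); apply: eq_card => v; rewrite inE; apply/eqP/imsetP => [av|[z _ ->]].
  exists [ffun q => (v q).2]; rewrite ?inE //; apply/ffunP => q.
  by rewrite /f av !ffunE; case: (v q) (b q) => [[] []] [].
by apply/ffunP => q; rewrite !ffunE; case: (a q) (b q) => [] [].
Qed.

(** Fourier inversion behind the Weyl expansion. For s = b the signs cancel and [card_flip] counts
    the terms; otherwise toggling Z at a site where [s] and [b] differ preserves both flips and
    negates each term. *)
Lemma sum_sign_flip (a b s : cbasis Q) (F : cbasis Q -> R[i]) :
  \sum_v (a == flip v b)%:R * (-1) ^+ (zdot v b (+) zdot v s) * F (flip v s) =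
  if s == b then (2 ^ #|Q|)%:R * F a else 0.
Proof.
case: eqVneq => [->|sb].
  rewrite (eq_bigr (fun v => if a == flip v b then F a else 0)); last first.
    move=> v _; rewrite addbb mulr1; case: eqVneq => [<-|_]; first by rewrite mul1r.
    by rewrite mul0r.
  rewrite -big_mkcond sumr_const -(card_flip a b) mulr_natl; congr (_ *+ _).
  by apply: eq_card => v; rewrite inE.
have [q sq] : exists q, s q != b q.
  apply/existsP; apply: contraNT sb => /existsPn e; apply/eqP/ffunP => q.
  exact/eqP/negPn/e.
pose e := at_site q (false, true).
have flip_e v t : flip (v + e) t = flip v t.
  by apply/ffunP => r; rewrite !ffunE; case: ifP; case: (v r) => [[] []].
have zdot_e t : zdot e t = t q.
  by rewrite /zdot (bigD1 q) //= big1 ?addbF ?ffunE ?eqxx // => r /negPf rq; rewrite ffunE rq.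
set S := (LHS); suff : S = - S.
  by move/eqP; rewrite -addr_eq0 -mulr2n mulrn_eq0 => /eqP.
rewrite {1}/S (reindex_inj (inv_inj (pauliDK e))) /= -sumrN; apply: eq_bigr => v _.
rewrite !flip_e !zdotD !zdot_e.
have -> : s q = ~~ b q by case: (s q) (b q) sq => [] [].
by case: (zdot v b) (zdot v s) (b q) => [] [] []; rewrite /= ?expr0 ?expr1; ring.
Qed.

Lemma weyl_expansion X :
  X = (2 ^ #|Q|)%:R^-1 *: \sum_v (\tr ((weyl v) ^t* *m X) *: weyl v).
Proof.
apply: op_ext => a b; rewrite entryZ entry_sum.
have -> : \sum_v entry (\tr ((weyl v) ^t* *m X) *: weyl v) a b =
   \sum_s \sum_v (a == flip v b)%:R * (-1) ^+ (zdot v b (+) zdot v s) * entry X (flip v s) s.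
  rewrite exchange_big; apply: eq_bigr => v _.
  rewrite entryZ trace_weyl_adj_mul entry_weyl mulr_suml; apply: eq_bigr => s _.
  rewrite signr_addb; ring.
under eq_bigr do rewrite (sum_sign_flip a b _ (fun x => entry X x _)).
rewrite -big_mkcond big_pred1_eq mulKf // pnatr_eq0 -lt0n expn_gt0 //.
Qed.

End Weyl.

(** * Action of the Clifford group *)

Lemma commute_conj (K : fieldType) m (A B V V' : 'M[K]_m) (c : K) (X : 'M[K]_m) :
    A *m B = 1%:M -> c != 0 -> A *m V = c *: (V' *m A) ->
  V' *m (A *m X *m B) = A *m X *m B *m V' <-> V *m X = X *m V.
Proof.
move=> AB c0 AV; have BA := mulmx1C AB.
have V'E : V' = c^-1 *: (A *m V *m B).
  by rewrite AV -scalemxAl scalerA mulVf // scale1r -mulmxA AB mulmx1.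
have -> : V' *m (A *m X *m B) = c^-1 *: (A *m (V *m X) *m B).
  by rewrite V'E -scalemxAl -!mulmxA (mulmxA B) BA mul1mx.
have -> : A *m X *m B *m V' = c^-1 *: (A *m (X *m V) *m B).
  by rewrite V'E -scalemxAr -!mulmxA (mulmxA B) BA mul1mx.
split=> [|->//]; have cancel Y : Y = c *: (B *m (c^-1 *: (A *m Y *m B)) *m A).
  rewrite -scalemxAr -scalemxAl scalerA mulfV // scale1r !mulmxA BA mul1mx.
  by rewrite -mulmxA BA mulmx1.
by move=> h; rewrite (cancel (V *m X)) h -cancel.
Qed.

Section CliffordAction.
Variables (R : realType) (Q : finType).
Implicit Types (q : Q) (u v w : pauli Q) (s t : cbasis Q) (U X : op R Q) (g h : bool -> bool -> R[i]).
Implicit Types (phi : pauli Q -> pauli Q).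
Local Notation W := (weyl R).

(** Later steps only read off which Weyl operators commute with an operator, so the phase [c] is
    recorded merely as nonzero. *)
Definition acts_as U phi :=
  U *m U ^t* = 1%:M /\ forall v, exists2 c : R[i], c != 0 & U *m W v = c *: (W (phi v) *m U).

Lemma acts_as_comp U V phi psi :
  acts_as U phi -> acts_as V psi -> acts_as (U *m V) (phi \o psi).
Proof.
move=> [UU Uphi] [VV Vpsi]; split.
  by rewrite trmx_mul map_mxM mulmxA -(mulmxA U) VV mulmx1.
move=> v; have [c c0 e] := Vpsi v; have [d d0 e'] := Uphi (psi v).
exists (c * d); first exact: mulf_neq0.
by rewrite -mulmxA e -scalemxAr !mulmxA e' -scalemxAl -!mulmxA scalerA.
Qed.

Definition same_off q s t := [forall r, (r != q) ==> (s r == t r)].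

Definition set_bit q t (b : bool) : cbasis Q := [ffun r => if r == q then b else t r].

Lemma same_off_set q s t : same_off q s t -> s = set_bit q t (s q).
Proof.
move=> /forallP st; apply/ffunP => r; rewrite ffunE; case: eqVneq => [->//|rq].
by apply/eqP; have := st r; rewrite rq.
Qed.

Lemma entry_gate g q s t :
  entry (one_qubit_gate g q) s t = if same_off q s t then g (s q) (t q) else 0.
Proof. by rewrite entry_mkop. Qed.

Lemma gate_mul g h q : one_qubit_gate g q *m one_qubit_gate h q =
  one_qubit_gate (fun a b => g a false * h false b + g a true * h true b) q.
Proof.
apply: op_ext => s t; rewrite entry_mul entry_gate.
have off b : same_off q (set_bit q t b) t.
  by apply/forallP => r; apply/implyP => /negPf rq; rewrite ffunE rq.
have bitq b : set_bit q t b q = b by rewrite ffunE eqxx.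
rewrite (bigD1 (set_bit q t false)) // (bigD1 (set_bit q t true)) /=; last first.
  by apply/eqP => /ffunP/(_ q); rewrite !bitq.
rewrite big1 ?addr0 => [|r /andP[rf rt]]; last first.
  rewrite !entry_gate; case: (boolP (same_off q r t)) => [rs|_]; last by rewrite mulr0.
  by case: (r q) (same_off_set rs) rf rt => ->; rewrite eqxx.
rewrite !entry_gate !off !bitq.
have soff b : same_off q s (set_bit q t b) = same_off q s t.
  by apply: eq_forallb => r; case: eqVneq => //= rq; rewrite ffunE (negPf rq).
by rewrite !soff; case: ifP => // _; rewrite !mul0r addr0.
Qed.

Lemma gate_id q : one_qubit_gate (fun a b => (a == b)%:R) q = 1%:M :> op R Q.
Proof.
apply: op_ext => s t; rewrite entry_id entry_gate; case: ifPn => [st|].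
  congr ((nat_of_bool _)%:R); apply/eqP/eqP => [e|->//].
  by rewrite (same_off_set st) e; apply/ffunP => r; rewrite ffunE; case: eqVneq => [->|].
by case: eqVneq => // -> /negP[]; apply/forallP => r; apply/implyP.
Qed.

Lemma gate_adj g q : (one_qubit_gate g q)^t* = one_qubit_gate (fun a b => (g b a)^*) q.
Proof.
apply: op_ext => s t; rewrite entry_adj !entry_gate.
have -> : same_off q t s = same_off q s t by apply: eq_forallb => r; rewrite (eq_sym (s r)).
by case: ifP => // _; rewrite conjC0.
Qed.

Lemma eq_gate g h q : (forall a b, g a b = h a b) -> one_qubit_gate g q = one_qubit_gate h q.
Proof. by move=> gh; apply: op_ext => s t; rewrite !entry_gate gh. Qed.

Lemma zdot_set_bit v q t :
  zdot v t = ((v q).2 && t q) (+) zdot (set_site v q 0) t.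
Proof.
rewrite /zdot (bigD1 q) //= [in RHS](bigD1 q) //= ffunE eqxx /=; congr (_ (+) _).
by apply: eq_bigr => r /negPf rq; rewrite ffunE rq.
Qed.

(** The last hypothesis is the (s, t) entry of the one-qubit relation g W_a = c_a W_(a' a) g. Signs
    and flips at the other qubits are the same on both sides, so this 2 x 2 check suffices. *)
Lemma gate_acts g q (a' : bool * bool -> bool * bool) (c : bool * bool -> R[i]) :
    one_qubit_gate g q *m (one_qubit_gate g q)^t* = 1%:M ->
    (forall a, c a != 0) ->
    (forall a (s t : bool), (-1) ^+ (a.2 && t) * g s (t (+) a.1) =
        c a * ((-1) ^+ ((a' a).2 && (s (+) (a' a).1)) * g (s (+) (a' a).1) t)) ->
  acts_as (one_qubit_gate g q) (fun v => set_site v q (a' (v q))).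
Proof.
move=> gg c0 gc; split=> // v; exists (c (v q)); first exact: c0.
apply: op_ext => s t; rewrite entryZ entry_mul_weyl entry_weyl_mul !entry_gate.
set v' := set_site v q _.
have -> : same_off q (flip v' s) t = same_off q s (flip v t).
  apply: eq_forallb => r; case: eqVneq => //= rq; rewrite !ffunE (negPf rq).
  by case: (s r) (t r) (v r) => [] [] [[] []].
case: ifPn => [st|_]; last by rewrite !mulr0.
rewrite (zdot_set_bit v q) (zdot_set_bit v' q) !signr_addb.
have -> : set_site v' q 0 = set_site v q 0.
  by apply/ffunP => r; rewrite !ffunE; case: eqVneq.
have -> : zdot (set_site v q 0) (flip v' s) = zdot (set_site v q 0) t.
  apply: eq_bigr => r _; rewrite !ffunE; case: eqVneq => //= rq.
  have := forallP st r; rewrite rq ffunE /= => /eqP ->.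
  by case: (t r) (v r) => [] [[] []].
have -> : v' q = a' (v q) by rewrite ffunE eqxx.
have -> : flip v' s q = s q (+) (a' (v q)).1 by rewrite !ffunE eqxx.
have -> : flip v t q = t q (+) (v q).1 by rewrite !ffunE.
by rewrite mulrAC gc; ring.
Qed.

Lemma hadamard_acts q : acts_as (hadamard R q) (hadamard_move q).
Proof.
pose r : R[i] := (sqrtC 2)^-1.
have r2 : r * r + r * r = 1.
  by rewrite -mulr2n -invfM -expr2 sqrtCK -(mulr_natr _^-1) mulVf // pnatr_eq0.
have rC : r^* = r by apply/CrealP/ger0_real; rewrite invr_ge0 sqrtC_ge0 ler0n.
apply: (gate_acts (a' := fun a => (a.2, a.1)) (c := fun a => (-1) ^+ (a.1 && a.2))).
- rewrite gate_adj gate_mul -(gate_id q); apply: eq_gate => a b.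
  rewrite !rmorphM !rmorph_sign -/r /= rC.
  by case: a b => [] [] /=; rewrite ?expr0 ?expr1 ?mul1r ?mulN1r ?mulrN ?mulNr ?opprK ?r2 ?subrr.
- by move=> a; rewrite signr_eq0.
by case=> [[] []] [] []; rewrite /= ?expr0 ?expr1; ring.
Qed.

Lemma phase_acts q : acts_as (phase_gate R q) (phase_move q).
Proof.
have i0 : 'i%C != 0 :> R[i] by rewrite neq0Ci.
have i2 : 'i%C * 'i%C = -1 :> R[i] by rewrite -expr2 sqrCi.
apply: (gate_acts (a' := fun a => (a.1, a.2 (+) a.1)) (c := fun a => if a.1 then 'i%C else 1)).
- rewrite gate_adj gate_mul -(gate_id q); apply: eq_gate => a b.
  case: a b => [] [] /=; rewrite ?mul0r ?mulr0 ?addr0 ?add0r ?conjC0 ?conjC1 ?conjCi ?mulr0 ?mulr1 //.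
  by rewrite mulrN i2 opprK.
- by move=> a; case: a.1 => //; apply: oner_neq0.
case=> [[] []] [] []; rewrite /= ?expr0 ?expr1 ?mulr0 ?mul1r ?mulr1 ?mulN1r ?mulrN ?i2 ?opprK //.
Qed.

Lemma cnot_mapK (c t : Q) : c != t -> involutive (cnot_map c t).
Proof.
move=> ct s; apply/ffunP => r; rewrite !ffunE eqxx (negPf ct).
by case: eqVneq => [->|//]; rewrite addbK.
Qed.

Lemma entry_cnot (c t : Q) x y : entry (cnot R c t) x y = (x == cnot_map c t y)%:R.
Proof. by rewrite entry_mkop; case: eqP. Qed.

Lemma cnot_acts (c t : Q) : c != t -> acts_as (cnot R c t) (cnot_move c t).
Proof.
move=> ct; have K := cnot_mapK ct.
have eK x y : (x == cnot_map c t y) = (y == cnot_map c t x).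
  by rewrite -(inj_eq (inv_inj K)) K eq_sym.
split.
  apply: op_ext => x y; rewrite entry_mul entry_id (bigD1 (cnot_map c t x)) //=.
  rewrite big1 => [|z]; last first.
    by rewrite entry_cnot (eK x) => /negPf ->; rewrite mul0r.
  rewrite entry_adj !entry_cnot K eqxx mul1r addr0 rmorph_nat.
  by rewrite eq_sym.
move=> v; exists 1; first exact: oner_neq0.
apply: op_ext => x y; rewrite entryZ mul1r entry_mul_weyl entry_weyl_mul !entry_cnot.
have fE : flip (cnot_move c t v) (cnot_map c t y) = cnot_map c t (flip v y).
  apply/ffunP => r; rewrite !ffunE ?(negPf ct); case: eqVneq => [_|_].
    by case: (y t) (y c) (v t) (v c) => [] [] [[] []] [[] []].
  by case: eqVneq => [->|//].
rewrite -flip_eq fE.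
case: eqVneq => [xE|_]; last by rewrite !mulr0.
rewrite !mulr1 xE -fE flipK; congr (_ ^+ nat_of_bool _).
rewrite /zdot [RHS](bigD1 t) // [LHS](bigD1 t) //= [in RHS](bigD1 c) // [in LHS](bigD1 c) //=.
rewrite !ffunE !eqxx (negPf ct) /= !addbA; congr (_ (+) _).
  by case: (y t) (y c) (v t) (v c) => [] [] [[] []] [[] []].
apply: eq_bigr => r /andP[rt rc]; rewrite !ffunE.
by rewrite (negPf rt) (negPf rc).
Qed.

Lemma clifford_acts U : clifford U -> exists2 phi, injective phi & acts_as U phi.
Proof.
elim => {U} [|q|q|c t ct|U V _ [phi phiI Uphi] _ [psi psiI Vpsi]].
- exists id => //; split; first by rewrite trmx1 map_mx1 mulmx1.
  by move=> v; exists 1; rewrite ?oner_neq0 // mul1mx mulmx1 scale1r.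
- exists (hadamard_move q); last exact: hadamard_acts.
  by have [_ /inv_inj] := hadamard_move_symplectic q.
- exists (phase_move q); last exact: phase_acts.
  by have [_ /inv_inj] := phase_move_symplectic q.
- exists (cnot_move c t); last exact: cnot_acts.
  by have [_ /inv_inj] := cnot_move_symplectic ct.
by exists (phi \o psi); [apply: inj_comp | apply: acts_as_comp].
Qed.

Definition stab X : {set pauli Q} := [set v | W v *m X == X *m W v].

Definition conj_op U X := U *m X *m U ^t*.

Lemma stab_conj U phi X v : acts_as U phi ->
  (phi v \in stab (conj_op U X)) = (v \in stab X).
Proof.
move=> [UU Uphi]; have [c c0 e] := Uphi v; rewrite !inE.
by apply/eqP/eqP => /(commute_conj X UU c0 e).
Qed.

Lemma stab_subgroup X : subgroup (stab X).
Proof.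
split; first by rewrite inE weyl0 mul1mx mulmx1.
move=> u v; rewrite !inE => /eqP uX /eqP vX.
have e : W (u + v) = (-1) ^+ zxdot u v *: (W u *m W v).
  by rewrite weylM scalerA -expr2 sqrr_sign scale1r.
by rewrite e -scalemxAl -scalemxAr -mulmxA vX mulmxA uX mulmxA.
Qed.

Definition pure X := exists2 psi : ket R Q, psi ^t* *m psi = 1%:M & X = projector psi.

Lemma pure_conj U X : U *m U ^t* = 1%:M -> pure X -> pure (conj_op U X).
Proof.
move=> UU [psi psi1 ->]; have UU' := mulmx1C UU.
exists (U *m psi); rewrite ?/projector trmx_mul map_mxM.
  by rewrite -mulmxA (mulmxA _ U) UU' mul1mx.
by rewrite /conj_op !mulmxA.
Qed.

Lemma pure_adj X : pure X -> X ^t* = X.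
Proof. by move=> [psi _ ->]; rewrite /projector trmx_mul map_mxM trmxCK. Qed.

Lemma pure_trace X : pure X -> \tr X = 1.
Proof. by move=> [psi psi1 ->]; rewrite /projector mxtrace_mulC psi1 mxtrace1. Qed.

Lemma pure_sandwich X Y : pure X -> X *m Y *m X = \tr (X *m Y) *: X.
Proof.
move=> [psi psi1 ->]; rewrite /projector.
have -> : psi *m psi ^t* *m Y *m (psi *m psi ^t* ) =
   psi *m (psi ^t* *m Y *m psi) *m psi ^t* by rewrite !mulmxA.
have -> : psi ^t* *m Y *m psi = (\tr (psi *m psi ^t* *m Y))%:M.
  by rewrite -(mulmxA psi) mxtrace_mulC trace_mx11 -mx11_scalar.
by rewrite mul_mx_scalar -scalemxAl.
Qed.

Lemma pure_idem X : pure X -> X *m X = X.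
Proof.
move=> pX; have := pure_sandwich 1%:M pX.
by rewrite mulmx1 pure_trace // scale1r.
Qed.

(** If [W w] commutes with the rank-one projector [X], then [W w *m X] is a multiple of [X]. Two
    such operators have commuting actions on [X]; if they also anticommuted, [X] would be zero,
    against its trace 1. *)
Lemma stab_isotropic X : pure X -> {in stab X &, forall u v, ~~ symp u v}.
Proof.
move=> pX u v; rewrite !inE => /eqP uX /eqP vX; apply/negP => uv.
have eig w : W w *m X = X *m W w -> W w *m X = \tr (X *m W w) *: X.
  by move=> wX; rewrite -pure_sandwich // -wX -mulmxA pure_idem.
have : W u *m (W v *m X) = W v *m (W u *m X).
  rewrite (eig v vX) -scalemxAr (eig u uX) scalerA mulrC -scalerA.
  by rewrite -(eig v vX) scalemxAr.
rewrite !mulmxA weylC uv expr1 scaleN1r mulNmx => /eqP.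
rewrite eq_sym -addr_eq0 -mulmxDr => /eqP e.
have Winv w : (W w) ^t* *m W w = 1%:M by apply/mulmx1C/weyl_adjM.
have cancel w Y : W w *m Y = 0 -> Y = 0.
  by move=> wY; rewrite -[Y]mul1mx -(Winv w) -mulmxA wY mulmx0.
move: e; rewrite -mulmxA => /cancel/cancel/(congr1 mxtrace).
rewrite mxtraceD (pure_trace pX) mxtrace0 => /eqP.
by rewrite -(natrD _ 1 1) pnatr_eq0.
Qed.

End CliffordAction.

(** * Stabilizer states *)

Section StabilizerStates.
Variables (R : realType) (Q : finType).
Implicit Types (u v w : pauli Q) (s t : cbasis Q) (U V P X : op R Q).
Local Notation W := (weyl R).

Lemma pure_ket0 : pure (projector (ket0 R Q)).
Proof.
exists (ket0 R Q) => //.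
by rewrite /ket0 trmx_delta map_delta_mx mul_delta_mx; apply/matrixP=> i j; rewrite !ord1 !mxE.
Qed.

Lemma entry_projector0 s t :
  entry (projector (ket0 R Q)) s t = ((s == [ffun=> false]) && (t == [ffun=> false]))%:R.
Proof.
rewrite /entry /projector /ket0 trmx_delta map_delta_mx mul_delta_mx mxE.
by rewrite !(inj_eq enum_rank_inj).
Qed.

Lemma stab_ket0 : stab (projector (ket0 R Q)) = [set v : pauli Q | [forall q, ~~ (v q).1]].
Proof.
apply/setP => v; rewrite !inE; apply/eqP/forallP => [vP q|vx].
  have := congr1 (fun M => entry M (flip v [ffun=> false]) [ffun=> false]) vP.
  rewrite entry_weyl_mul entry_mul_weyl flipK !entry_projector0 eqxx.
  case: eqVneq => [/ffunP/(_ q)|_]; first by rewrite !ffunE addFb => ->.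
  by rewrite mulr0 mulr1 => /eqP; rewrite signr_eq0.
have fv t : flip v t = t by apply/ffunP => q; rewrite !ffunE (negPf (vx q)) addbF.
apply: op_ext => s t; rewrite entry_weyl_mul entry_mul_weyl !fv entry_projector0.
have [->|_] := eqVneq s; have [->|_] := eqVneq t; rewrite ?mulr0 //=.
Qed.

Lemma card_stab_ket0 : #|stab (projector (ket0 R Q))| = (2 ^ #|Q|)%N.
Proof.
have <- : #|[pred a : bool * bool | ~~ a.1]| = 2%N.
  rewrite (eq_card (B := [predX pred1 false & predT])) => [|[[] b] //].
  by rewrite cardX card1 card_bool.
rewrite -card_ffun_on stab_ket0; apply: eq_card => v; rewrite inE.
by apply/forallP/ffun_onP => h q; have := h q; rewrite inE.
Qed.

Lemma stab_conj_op U phi X : acts_as U phi -> injective phi ->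
  stab (conj_op U X) = [set phi v | v in stab X].
Proof.
move=> Uphi phiI; apply/setP => v; have [psi psiK phiK] := injF_bij phiI.
by rewrite -[v]phiK (stab_conj _ _ Uphi) (mem_imset _ _ phiI).
Qed.

Lemma stabilizer_stateP P : stabilizer_states P -> pure P /\ lagrangian (stab P).
Proof.
move=> [U cU ->].
have -> : projector (U *m ket0 R Q) = conj_op U (projector (ket0 R Q)).
  by rewrite /projector /conj_op trmx_mul map_mxM !mulmxA.
have [phi phiI [UU Uphi]] := clifford_acts cU.
have pP : pure (conj_op U (projector (ket0 R Q))) by apply: pure_conj UU pure_ket0.
split=> //; apply: isotropic_lagrangian; first exact: stab_subgroup.
  by rewrite (stab_conj_op _ (conj UU Uphi) phiI) card_imset // card_stab_ket0.
exact: stab_isotropic.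
Qed.

Lemma stabilizer_state_conj U P : clifford U -> stabilizer_states P ->
  stabilizer_states (conj_op U P).
Proof.
move=> cU [V cV ->]; exists (U *m V); first exact: clifford_mul.
by rewrite /projector /conj_op !trmx_mul !map_mxM !mulmxA.
Qed.

(* For v in the stabilizer of P, coef P v *: W v is the signed Pauli fixing P. *)
Definition coef P v : R[i] := \tr ((W v) ^t* *m P).

Section Coefficients.
Variable P : op R Q.
Hypotheses (pP : pure P) (lP : lagrangian (stab P)).

(** By duality some [w] of the stabilizer anticommutes with [v]. Conjugation by [W w] fixes [P] and
    negates [W v], which forces the trace to vanish. *)
Lemma coef_eq0 v : v \notin stab P -> coef P v = 0.
Proof.
case: (lP) => _ _ ->; rewrite negb_forall_in => /exists_inP[w wP /negPn vw].
move: wP; rewrite inE => /eqP wP.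
have W1 : W w *m (W w) ^t* = 1%:M by apply: weyl_adjM.
have W2 : (W w) ^t* *m W w = 1%:M by apply: mulmx1C.
have WvW : (W w) ^t* *m (W v *m W w) = - W v.
  by rewrite weylC sympC vw expr1 scaleN1r mulmxN mulmxA W2 mul1mx.
have PE : P = W w *m P *m (W w)^t* by rewrite wP -mulmxA W1 mulmx1.
have e : \tr (W v *m P) = - \tr (W v *m P).
  by rewrite {1}PE !mulmxA mxtrace_mulC !mulmxA -(mulmxA _ (W v)) WvW mulNmx raddfN.
rewrite /coef weyl_adj -scalemxAl mxtraceZ.
by move/eqP: e; rewrite -addr_eq0 -mulr2n mulrn_eq0 => /eqP ->; rewrite mulr0.
Qed.

Lemma coef_weyl v : v \in stab P -> coef P v *: W v *m P = P.
Proof.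
rewrite inE => /eqP vP.
have W2 : (W v) ^t* *m W v = 1%:M by apply/mulmx1C/weyl_adjM.
have e : W v *m P = \tr (W v *m P) *: P.
  by rewrite [in RHS]mxtrace_mulC -pure_sandwich // -vP -mulmxA pure_idem.
have : (W v) ^t* *m P = coef P v *: P.
  by rewrite /coef weyl_adj -scalemxAl mxtraceZ -scalerA -e.
move/(congr1 (mulmx (W v))); rewrite mulmxA weyl_adjM mul1mx => PE.
by rewrite -scalemxAl scalemxAr.
Qed.

(** The operators [coef P v *: W v] all fix [P], hence so do their products. A multiple of
    [W (u + v)] that fixes [P] is unique, as [P] has nonzero trace. *)
Lemma coefM u v : u \in stab P -> v \in stab P ->
  coef P u * coef P v * (-1) ^+ zxdot u v = coef P (u + v).
Proof.
move=> uP vP; have uvP : u + v \in stab P by have [_ ->] := stab_subgroup P.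
have scal a b w : w \in stab P -> a *: W w *m P = P -> b *: W w *m P = P -> a = b.
  move=> wP ha hb.
  have aP : a *: P = b *: P.
    rewrite -{1}hb -{2}ha -!scalemxAl !scalerA; by rewrite mulrC.
  have := congr1 mxtrace aP.
  by rewrite !mxtraceZ pure_trace // !mulr1.
apply: (scal _ _ _ uvP); last exact: coef_weyl.
have e : coef P u *: W u *m (coef P v *: W v *m P) = P by rewrite !coef_weyl.
by rewrite -[RHS]e mulmxA -[_ *m (_ *: W v)]scalemxAl -[W u *m _]scalemxAr weylM !scalerA.
Qed.

Lemma coef0 : coef P 0 = 1.
Proof. by rewrite /coef weyl0 trmx1 map_mx1 mul1mx pure_trace. Qed.

Lemma coef_sq v : v \in stab P -> coef P v ^+ 2 = (-1) ^+ zxdot v v.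
Proof.
move=> vP; have := coefM vP vP; rewrite pauliDD coef0 -expr2.
case: (zxdot v v); rewrite ?expr0 ?expr1 ?mulr1 // mulrN1 => /eqP.
by rewrite eqr_oppLR => /eqP.
Qed.

Lemma stabilizer_expansion :
  P = (2 ^ #|Q|)%:R^-1 *: \sum_(v in stab P) (coef P v *: W v).
Proof.
rewrite {1}(weyl_expansion P); congr (_ *: _); rewrite [RHS]big_mkcond.
by apply: eq_bigr => v _; case: ifPn => // /coef_eq0; rewrite /coef => ->; rewrite scale0r.
Qed.

End Coefficients.
End StabilizerStates.

(** * Partial trace and partial transpose *)

(** In M M, replacing v by u + v leaves the sign [beta u v], since [beta] is alternating; the
    character sum over [u] then kills every [v] outside the radical [Z] and gives |G| otherwise. For
    v in [Z] multiplication by [t v] permutes the terms of [M] without signs, so each of the |Z|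
    terms reproduces [M]. *)
Lemma twisted_sum_sq (K : numDomainType) (m : nat) (Q : finType) (G : {set pauli Q})
    (t : pauli Q -> 'M[K]_m) (beta : pauli Q -> pauli Q -> bool) :
    subgroup G ->
    {in G & &, forall u v w, beta (u + v) w = beta u w (+) beta v w} ->
    {in G & &, forall u v w, beta u (v + w) = beta u v (+) beta u w} ->
    {in G, forall u, ~~ beta u u} ->
    {in G &, forall u v, t u *m t v = (-1) ^+ beta u v *: t (u + v)} ->
  let M := \sum_(u in G) t u in
  let Z := [set v in G | [forall u in G, ~~ beta u v]] in
  M *m M = #|G|%:R *: \sum_(v in Z) t v /\
  M *m M *m M = (#|G| * #|Z|)%:R *: M.
Proof.
move=> sG betaDl betaDr beta0 tM M Z.
have [G0 GD] := sG.
have MM : M *m M = #|G|%:R *: \sum_(v in Z) t v.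
  rewrite /M mulmx_suml.
  transitivity (\sum_(u in G) \sum_(v in G) (-1) ^+ beta u v *: t v).
    apply: eq_bigr => u uG; rewrite mulmx_sumr (reindex_inj (inv_inj (pauliDK u))) /=.
    apply: eq_big => v; first by rewrite subgroupDr.
    rewrite subgroupDr // => vG; rewrite tM ?GD // addrCA pauliDD addr0.
    by rewrite betaDr // (negPf (beta0 u uG)) addbF.
  rewrite exchange_big scaler_sumr [RHS]big_mkcond [LHS]big_mkcond; apply: eq_bigr => v _.
  rewrite inE; case: ifP => //= vG; rewrite -scaler_suml character_sum //.
    by case: ifP; rewrite ?scale0r.
  by move=> u w uG wG /=; rewrite betaDl.
split=> //; rewrite MM -scalemxAl natrM -scalerA; congr (_ *: _).
rewrite mulmx_suml -[#|Z|]sum1_card natr_sum scaler_suml; apply: eq_bigr => v.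
rewrite inE => /andP[vG /forall_inP vZ]; rewrite scale1r mulmx_sumr.
rewrite (reindex_inj (inv_inj (pauliDK v))) /=.
apply: eq_big => u; first by rewrite subgroupDr.
rewrite subgroupDr // => uG; rewrite tM ?GD // addrCA pauliDD addr0.
have uvG := GD _ _ uG vG; move: (beta0 _ uvG).
rewrite betaDl // !betaDr // (negPf (beta0 u uG)) (negPf (beta0 v vG)) addbF addFb.
by rewrite (negPf (vZ u uG)) addFb => /negPf ->; rewrite scale1r.
Qed.

Section Bipartite.
Variables (R : realType) (A B : finType).
Implicit Types (v : pauli (A + B)%type) (x : cbasis A) (z : cbasis B) (X Y : op R (A + B)%type).

Definition left_part v : pauli A := [ffun a => v (inl a)].
Definition right_part v : pauli B := [ffun b => v (inr b)].

Lemma zdot_join v x z : zdot v (join x z) = zdot (left_part v) x (+) zdot (right_part v) z.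
Proof.
by rewrite /zdot big_sumType; congr (_ (+) _); apply: eq_bigr => q _; rewrite !ffunE.
Qed.

Lemma zxdot_parts u v : zxdot u v =
  zxdot (left_part u) (left_part v) (+) zxdot (right_part u) (right_part v).
Proof.
by rewrite /zxdot big_sumType; congr (_ (+) _); apply: eq_bigr => q _; rewrite !ffunE.
Qed.

Lemma flip_join v x z :
  flip v (join x z) = join (flip (left_part v) x) (flip (right_part v) z).
Proof. by apply/ffunP => -[q|q]; rewrite !ffunE. Qed.

Lemma eq_join x x' z z' : (join x z == join x' z') = (x == x') && (z == z').
Proof.
apply/eqP/andP => [/ffunP e|[/eqP-> /eqP->] //].
by split; apply/eqP/ffunP => q; [have := e (inl q)|have := e (inr q)]; rewrite !ffunE.
Qed.

Lemma partial_trace_weyl v :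
  partial_trace (weyl R v) = \tr (weyl R (right_part v)) *: weyl R (left_part v).
Proof.
apply: op_ext => x y; rewrite entryZ entry_mkop trace_entry mulr_suml.
apply: eq_bigr => z _; rewrite !entry_weyl flip_join zdot_join eq_join signr_addb.
by rewrite -mulnb natrM mulrACA [RHS]mulrC.
Qed.

Lemma partial_trace_sum (I : finType) (S : {pred I}) (a : R[i]) (F : I -> op R (A + B)%type) :
  partial_trace (a *: \sum_(i in S) F i) = a *: \sum_(i in S) partial_trace (F i).
Proof.
apply: op_ext => x y; rewrite entryZ entry_sum !entry_mkop.
under eq_bigr do rewrite entryZ entry_sum.
rewrite -mulr_sumr exchange_big; congr (_ * _); apply: eq_bigr => i _.
by rewrite entry_mkop.
Qed.

Lemma partial_traceZ a X : partial_trace (a *: X) = a *: partial_trace X.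
Proof.
apply: op_ext => x y; rewrite entryZ !entry_mkop mulr_sumr.
by apply: eq_bigr => z _; rewrite entryZ.
Qed.

Lemma trace_partial_trace X : \tr (partial_trace X) = \tr X.
Proof.
rewrite !trace_entry; under eq_bigr do rewrite entry_mkop.
rewrite pair_big /= (reindex (fun p : cbasis A * cbasis B => join p.1 p.2)) //=.
pose f (s : cbasis (A + B)%type) : cbasis A * cbasis B :=
  ([ffun a => s (inl a)], [ffun b => s (inr b)]).
exists f => [[x z] _|s _]; rewrite /f /=; last by apply/ffunP => -[q|q]; rewrite !ffunE.
by congr (_, _); apply/ffunP => q; rewrite !ffunE.
Qed.

Lemma partial_trace_adj X : (partial_trace X)^t* = partial_trace (X ^t* ).
Proof.
apply: op_ext => x y; rewrite entry_adj !entry_mkop rmorph_sum.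
by apply: eq_bigr => z _; rewrite entry_adj.
Qed.

(** On B transposition turns X^x Z^z into Z^z X^x, and reordering costs the sign (-1)^(x.z). *)
Lemma partial_transpose_weyl v : partial_transpose (weyl R v) =
  (-1) ^+ zxdot (right_part v) (right_part v) *: weyl R v.
Proof.
apply: op_ext => x y; rewrite entryZ entry_mkop !entry_weyl.
have -> : (splice x y == flip v (splice y x)) = (x == flip v y).
  apply/eqP/eqP => /ffunP e; apply/ffunP => q; have := e q; rewrite !ffunE.
    by case: q => q; case: (x _) (y _) (v _) => [] [] [[] []].
  by case: q => q; case: (x _) (y _) (v _) => [] [] [[] []].
case: eqP => [xE|_]; last by rewrite !mul0r mulr0.
rewrite !mul1r -signr_addb; congr (_ ^+ nat_of_bool _).
rewrite /zdot /zxdot !big_sumType /= addbCA; congr (_ (+) _).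
  by apply: eq_bigr => q _; rewrite ffunE.
rewrite -big_split; apply: eq_bigr => q _; rewrite xE !ffunE /=.
by case: (y _) (v _) => [] [[] []].
Qed.

Lemma partial_transpose_sum (I : finType) (S : {pred I}) (a : R[i]) (F : I -> op R (A + B)%type) :
  partial_transpose (a *: \sum_(i in S) F i) = a *: \sum_(i in S) partial_transpose (F i).
Proof.
apply: op_ext => x y; rewrite entryZ entry_sum entry_mkop entryZ entry_sum.
by congr (_ * _); apply: eq_bigr => i _; rewrite entry_mkop.
Qed.

Lemma partial_transposeZ a X : partial_transpose (a *: X) = a *: partial_transpose X.
Proof. by apply: op_ext => x y; rewrite entryZ !entry_mkop entryZ. Qed.

Lemma trace_partial_transpose X : \tr (partial_transpose X) = \tr X.
Proof.
rewrite !trace_entry; apply: eq_bigr => x _; rewrite entry_mkop.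
by have -> : splice x x = x by apply/ffunP => -[q|q]; rewrite ffunE.
Qed.

Lemma partial_transpose_adj X : (partial_transpose X)^t* = partial_transpose (X ^t* ).
Proof. by apply: op_ext => x y; rewrite entry_adj !entry_mkop entry_adj. Qed.

End Bipartite.

Section TraceNorm.
Variables (R : realType) (Q : finType).

(* X^3 = c X for Hermitian X forces the eigenvalues into {0, sqrt c, - sqrt c}. *)
Lemma trace_norm_cube (X : op R Q) (c : R) : 0 < c -> X ^t* = X ->
  X *m X *m X = (c%:C)%C *: X -> trace_norm X = complex.Re (\tr (X *m X)) / Num.sqrt c.
Proof.
move=> c0 Xadj X3; rewrite /trace_norm Xadj; set H := X *m X.
have Hadj : H ^t* = H by rewrite /H trmx_mul map_mxM Xadj.
have Hn : H \is normalmx by apply/normalmxP; rewrite Hadj.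
have HH : H *m H = (c%:C)%C *: H by rewrite /H !mulmxA X3 -scalemxAl.
move: {Hadj} H Hn HH => H Hn HH.
have HE := orthomx_spectralP Hn; have Pu := spectral_unit H.
set P := spectralmx H in HE Pu; set d := spectral_diag H in HE *.
have DE : diag_mx d = P *m H *m invmx P.
  by rewrite HE !mulmxA mulmxV // mul1mx -mulmxA mulmxV // mulmx1.
have DD : diag_mx d *m diag_mx d = (c%:C)%C *: diag_mx d.
  rewrite DE !mulmxA -(mulmxA (P *m H)) mulVmx // mulmx1 -[P *m H *m H]mulmxA HH.
  by rewrite -scalemxAr -scalemxAl.
have dE i : d 0 i = 0 \/ d 0 i = (c%:C)%C.
  have := congr1 (fun M => fun_of_matrix M i i) DD.
  rewrite mul_diag_mx !mxE eqxx /= !mulr1n => /eqP; rewrite -subr_eq0 -mulrBl mulf_eq0.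
  by rewrite subr_eq0 => /orP[/eqP|/eqP]; [right|left].
have -> : \tr H = \sum_i d 0 i.
  by rewrite HE mxtrace_mulC mulmxA mulmxV // mul1mx mxtrace_diag.
rewrite raddf_sum mulr_suml; apply: eq_bigr => i _; have [->|->] := dE i.
  by rewrite sqrtr0 mul0r.
by rewrite -{2}(sqr_sqrtr (ltW c0)) expr2 mulfK // gt_eqF // sqrtr_gt0.
Qed.

End TraceNorm.

(** * Negativity of a stabilizer state *)

Lemma twisted_sign (K : comPzRingType) (x y : K) (a b c d e : bool) :
  x * (-1) ^+ b * (y * (-1) ^+ c) * (-1) ^+ a =
  (-1) ^+ (e (+) d) * (x * y * (-1) ^+ a * (-1) ^+ (b (+) e (+) (d (+) c))).
Proof.
by case: a b c d e => [] [] [] [] []; rewrite /= ?expr0 ?expr1; ring.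
Qed.

Section Tripartite.
Variables (R : realType) (A B C : finType).
Local Notation Q := ((A + B + C)%type : finType).
Local Notation W := (weyl R).
Implicit Types (u v : pauli Q).

Definition regionA : {set Q} := [set q | if q is inl (inl _) then true else false].
Definition regionB : {set Q} := [set q | if q is inl (inr _) then true else false].
Definition regionC : {set Q} := [set q | if q is inr _ then true else false].

Lemma regions_tripartition : tripartition regionA regionB regionC.
Proof. by case=> [[a|b]|c]; rewrite !inE. Qed.

Lemma card_regionA : #|regionA| = #|A|.
Proof.
have inj : injective (fun a : A => inl (inl a) : Q) by move=> ? ? [].
rewrite -cardsT -(card_imset _ inj); apply: eq_card => q; rewrite inE.
apply/idP/imsetP => [|[? _ ->] //].
by case: q => [[a|b]|c] // _; exists a.
Qed.

Lemma card_regionB : #|regionB| = #|B|.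
Proof.
have inj : injective (fun b : B => inl (inr b) : Q) by move=> ? ? [].
rewrite -cardsT -(card_imset _ inj); apply: eq_card => q; rewrite inE.
apply/idP/imsetP => [|[? _ ->] //].
by case: q => [[a|b]|c] // _; exists b.
Qed.

Lemma card_regionC : #|regionC| = #|C|.
Proof.
have inj : injective (fun c : C => inr c : Q) by move=> ? ? [].
rewrite -cardsT -(card_imset _ inj); apply: eq_card => q; rewrite inE.
apply/idP/imsetP => [|[? _ ->] //].
by case: q => [[a|b]|c] // _; exists c.
Qed.

Lemma supported_regionAB v : (v \in supported (regionA :|: regionB)) = (right_part v == 0).
Proof.
rewrite inE; apply/eqP/eqP => [/ffunP e|/ffunP e]; apply/ffunP => q.
  by have := e (inr q); rewrite !ffunE !inE /= => <-.
rewrite ffunE !inE; case: q => [[a|b]|c] //=.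
by have := e c; rewrite !ffunE => ->.
Qed.

Lemma left_partD (D E : finType) (u v : pauli (D + E)%type) :
  left_part (u + v) = left_part u + left_part v.
Proof. by apply/ffunP => q; rewrite !ffunE. Qed.

Lemma right_partD (D E : finType) (u v : pauli (D + E)%type) :
  right_part (u + v) = right_part u + right_part v.
Proof. by apply/ffunP => q; rewrite !ffunE. Qed.

Lemma symp_parts (D E : finType) (u v : pauli (D + E)%type) :
  symp u v = symp (left_part u) (left_part v) (+) symp (right_part u) (right_part v).
Proof.
by rewrite /symp big_sumType; congr (_ (+) _); apply: eq_bigr => q _; rewrite !ffunE.
Qed.

Lemma symp_regionA u v :
  symp (restrict regionA u) v = symp (left_part (left_part u)) (left_part (left_part v)).
Proof.
rewrite !symp_parts.
have -> : left_part (left_part (restrict regionA u)) = left_part (left_part u).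
  by apply/ffunP => q; rewrite !ffunE inE.
have -> : right_part (left_part (restrict regionA u)) = 0.
  by apply/ffunP => q; rewrite !ffunE inE.
have -> : right_part (restrict regionA u) = 0 by apply/ffunP => q; rewrite !ffunE inE.
by rewrite !symp0l !addbF.
Qed.

Variable P : op R Q.
Hypotheses (pP : pure P) (lP : lagrangian (stab P)).

Local Notation G := (local (stab P) (regionA :|: regionB)).
Local Notation Z := (radical (stab P) regionA regionB).

Let M := partial_transpose (partial_trace P).

Definition transposed_stabilizer v : op R (A + B)%type :=
  (coef P v * (-1) ^+ zxdot (right_part (left_part v)) (right_part (left_part v)))
    *: W (left_part v).
Local Notation t := transposed_stabilizer.

Lemma in_local_AB v : (v \in G) = (v \in stab P) && (right_part v == 0).
Proof. by rewrite inE supported_regionAB. Qed.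

Lemma transposed_stateE : M = (2 ^ (#|A| + #|B|))%:R^-1 *: \sum_(v in G) t v.
Proof.
rewrite /M {1}(stabilizer_expansion lP) partial_trace_sum partial_transpose_sum.
have -> : (2 ^ (#|A| + #|B|))%:R^-1 = (2 ^ #|Q|)%:R^-1 * (2 ^ #|C|)%:R :> R[i].
  have C0 : (2 ^ #|C|)%:R != 0 :> R[i] by rewrite pnatr_eq0 -lt0n expn_gt0.
  by rewrite !card_sum [in RHS]expnD natrM invfM divfK.
rewrite -scalerA; congr (_ *: _); rewrite scaler_sumr [LHS]big_mkcond [RHS]big_mkcond.
apply: eq_bigr => v _; rewrite in_local_AB; case: ifP => //= vS.
rewrite partial_traceZ partial_trace_weyl trace_weyl !partial_transposeZ.
rewrite partial_transpose_weyl !scalerA; case: ifP => _; last by rewrite mulr0 mul0r scale0r.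
by congr (_ *: _); rewrite -mulrA mulrCA.
Qed.

(** The transposition sign is the quadratic form [zxdot v v] on B, whose polarization is the
    symplectic form on B; this is the twist. It equals the form on A because elements of G commute
    and vanish on C. *)
Lemma transposed_stabilizerM : {in G &, forall u v,
  t u *m t v = (-1) ^+ symp (restrict regionA u) v *: t (u + v)}.
Proof.
move=> u v; rewrite !in_local_AB => /andP[uS /eqP uC] /andP[vS /eqP vC].
rewrite /t -scalemxAl -scalemxAr weylM !scalerA -left_partD; congr (_ *: _).
rewrite -(coefM pP uS vS).
have -> : zxdot u v = zxdot (left_part u) (left_part v).
  have z0 : zxdot (0 : pauli C) 0 = false by apply: big1 => q _; rewrite ffunE.
  by rewrite zxdot_parts uC vC z0 addbF.
have suv := symp_lagrangian lP uS vS.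
have : symp (restrict regionA u) v =
    symp (right_part (left_part u)) (right_part (left_part v)).
  rewrite symp_regionA; move: suv; rewrite !symp_parts uC symp0l addbF.
  by case: (symp _ _) (symp _ _) => [] [].
move=> ->; rewrite symp_zxdot !left_partD !right_partD !zxdotDl !zxdotDr.
exact: twisted_sign.
Qed.

Lemma trace_transposed_stabilizer v : v \in G ->
  \tr (t v) = if v == 0 then (2 ^ (#|A| + #|B|))%:R else 0.
Proof.
rewrite in_local_AB => /andP[_ /eqP vC].
rewrite /t mxtraceZ trace_weyl card_sum.
have -> : (left_part v == 0) = (v == 0).
  apply/eqP/eqP => [/ffunP vl|->]; last by apply/ffunP => q; rewrite !ffunE.
  apply/ffunP => -[q|q]; first by have := vl q; rewrite !ffunE.
  by move/ffunP: vC => /(_ q); rewrite !ffunE.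
case: eqVneq => [->|_]; last by rewrite mulr0.
rewrite (coef0 pP) mul1r (_ : zxdot _ _ = false) ?expr0 ?mul1r //.
by apply: big1 => q _; rewrite !ffunE.
Qed.

Let N : R := (2 ^ (#|A| + #|B|))%:R.
Let cube_factor : R := (#|G| * #|Z|)%:R / N ^+ 2.

Let N_gt0 : 0 < N.
Proof. by rewrite ltr0n expn_gt0. Qed.

Let cube_factor_gt0 : 0 < cube_factor.
Proof.
rewrite divr_gt0 ?exprn_gt0 // ltr0n muln_gt0 local_gt0 //.
exact: (radical_gt0 lP regionA regionB).
Qed.

Let natC (k : nat) : (k%:R : R[i]) = (k%:R%:C)%C.
Proof. by rewrite rmorph_nat. Qed.

Lemma transposed_state_powers :
  \tr (M *m M) = ((#|G|%:R / N)%:C)%C /\ M *m M *m M = (cube_factor%:C)%C *: M.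
Proof.
have sG : subgroup G by apply: subgroup_local.
pose beta u v := symp (restrict regionA u) v.
have bl : {in G & &, forall u v w, beta (u + v) w = beta u w (+) beta v w}.
  by move=> u v w _ _ _; rewrite /beta restrictD sympDl.
have br : {in G & &, forall u v w, beta u (v + w) = beta u v (+) beta u w}.
  by move=> u v w _ _ _; rewrite /beta sympDr.
have b0 : {in G, forall u, ~~ beta u u}.
  by move=> u _; rewrite /beta symp_regionA symp_self.
have [sq cube] := twisted_sum_sq sG bl br b0 transposed_stabilizerM.
have ZE : Z = [set v in G | [forall u in G, ~~ beta u v]].
  apply/setP => v; rewrite !inE; congr (_ && _); apply: eq_forallb => u.
  by rewrite /beta symp_restrictl sympC.
rewrite -ZE in sq cube.
have NC : (2 ^ (#|A| + #|B|))%:R^-1 = (N^-1%:C)%C :> R[i] by rewrite fmorphV /= -natC.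
rewrite transposed_stateE NC; split.
  rewrite -scalemxAl -scalemxAr scalerA sq scalerA mxtraceZ raddf_sum /=.
  rewrite (bigD1 (0 : pauli Q)) /=; last exact: (radical0 lP).
  rewrite trace_transposed_stabilizer ?eqxx; last by have [] := sG.
  rewrite big1 => [|v /andP[vZ /negPf v0]]; last first.
    rewrite trace_transposed_stabilizer ?v0 //.
    by move: vZ; rewrite inE => /andP[].
  rewrite addr0 natC -/N natC -!rmorphM /=; congr (_%:C)%C.
  by move: N (lt0r_neq0 N_gt0) (#|G|%:R : R) => n n0 g; field.
move: (\sum_(v in G) t v) cube => S cube.
rewrite -[_ *: S *m _]scalemxAl -[S *m _]scalemxAr -!scalemxAl -scalemxAr cube !scalerA.
rewrite natC -!rmorphM /=; congr (_%:C *: _)%C; rewrite /cube_factor.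
by move: N (lt0r_neq0 N_gt0) (_%:R : R) => n n0 g; field.
Qed.

Lemma pt_moment2 : pt_moment 2 (partial_trace P) = #|G|%:R / N.
Proof. by rewrite /pt_moment expr2 (proj1 transposed_state_powers). Qed.

Lemma trace_transposed_state : \tr M = 1.
Proof. by rewrite trace_partial_transpose trace_partial_trace pure_trace. Qed.

Lemma pt_moment3 : pt_moment 3 (partial_trace P) = cube_factor.
Proof.
have [_ cube] := transposed_state_powers.
rewrite /pt_moment exprS expr2 mulrA.
rewrite -/M (_ : M * M * M = M *m M *m M) // cube mxtraceZ.
by rewrite trace_transposed_state mulr1.
Qed.

Lemma negativity3_stabilizer :
  negativity3 (partial_trace P) = ln (#|G|%:R / #|Z|%:R) / 2%:R.
Proof.
rewrite /negativity3 pt_moment2 pt_moment3 /cube_factor natrM; congr (ln _ / _).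
have G0 : #|G|%:R != 0 :> R by rewrite pnatr_eq0 -lt0n local_gt0.
have Z0 : #|Z|%:R != 0 :> R.
  by rewrite pnatr_eq0 -lt0n; apply: (radical_gt0 lP regionA regionB).
have N0 := lt0r_neq0 N_gt0.
by move: N N0 => n n0; field; rewrite n0 Z0 G0.
Qed.

(** If c is the cube factor, the trace norm is p_2 / sqrt c, while p_3 = c because the transposed
    state has trace 1. So p_2^2 / p_3 is the square of the trace norm, and the factor 1/2 in the
    definition of [negativity3] undoes the square. *)
Lemma log_negativity_stabilizer :
  log_negativity (partial_trace P) = negativity3 (partial_trace P).
Proof.
have [sq cube] := transposed_state_powers.
have Madj : M ^t* = M.
  by rewrite partial_transpose_adj partial_trace_adj (pure_adj pP).
have p2 : 0 < pt_moment 2 (partial_trace P).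
  by rewrite pt_moment2 divr_gt0 // ltr0n local_gt0.
have E : trace_norm M = pt_moment 2 (partial_trace P) / Num.sqrt cube_factor.
  by rewrite (trace_norm_cube cube_factor_gt0 Madj cube) /pt_moment expr2.
rewrite /log_negativity /negativity3 -/M E pt_moment3.
set x := _ / Num.sqrt _.
have x0 : 0 < x by rewrite divr_gt0 // sqrtr_gt0.
have -> : pt_moment 2 (partial_trace P) ^+ 2 / cube_factor = x ^+ 2.
  by rewrite /x expr_div_n sqr_sqrtr // ltW.
by rewrite lnXn // -(mulr_natr (ln x)) mulfK // pnatr_eq0.
Qed.

End Tripartite.

(** * The uniform ensemble of stabilizer states *)

Local Open Scope classical_set_scope.

Section Ensemble.
Variables (R : realType) (Q : finType).
Implicit Types (u v : pauli Q) (U P : op R Q).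
Local Notation F := (fset_set (@stabilizer_states R Q)).

(** [fset_set] is empty on an infinite set, so the average is meaningful only after this. A state is
    determined by its 4^n Weyl coefficients, each 0 or a fourth root of unity by [coef_sq]. *)
Lemma stabilizer_states_finite : finite_set (@stabilizer_states R Q).
Proof.
pose roots : 'I_5 -> R[i] := fun i => nth 0 [:: 0; 1; -1; 'i%C; - 'i%C] i.
pose f (g : {ffun pauli Q -> 'I_5}) : op R Q :=
  (2 ^ #|Q|)%:R^-1 *: \sum_v (roots (g v) *: weyl R v).
apply: sub_finite_set (finite_image f finite_finset : finite_set (f @` setT)) => P.
move=> /stabilizer_stateP[pP lP].
have rootsP v : exists i, roots i = coef P v.
  have [vP|vP] := boolP (v \in stab P); last first.
    by exists (inord 0); rewrite coef_eq0 // /roots inordK.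
  have := coef_sq pP vP; case: (zxdot v v); rewrite ?expr0 ?expr1.
    rewrite -(sqrCi (R[i])) => /eqP; rewrite eqf_sqr => /orP[] /eqP ->.
      by exists (inord 3); rewrite /roots inordK.
    by exists (inord 4); rewrite /roots inordK.
  move=> /eqP; rewrite sqrf_eq1 => /orP[] /eqP ->.
    by exists (inord 1); rewrite /roots inordK.
  by exists (inord 2); rewrite /roots inordK.
have [g gP] := choice rootsP.
exists [ffun v => g v] => //.
rewrite /f [RHS](stabilizer_expansion lP); congr (_ *: _).
rewrite [RHS]big_mkcond; apply: eq_bigr => v _; rewrite ffunE gP.
by case: ifPn => // /(coef_eq0 lP) ->; rewrite scale0r.
Qed.

Lemma in_ensemble P : (P \in F) <-> stabilizer_states P.
Proof. by rewrite in_fset_set ?inE //; apply: stabilizer_states_finite. Qed.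

Lemma ensemble_gt0 : (0 < #|` F|)%N.
Proof.
rewrite cardfs_gt0; apply/fset0Pn; exists (projector (1%:M *m ket0 R Q)).
by apply/in_ensemble; exists 1%:M => //; apply: clifford_id.
Qed.

Lemma ensemble_conj (U : op R Q) : clifford U -> perm_eq [seq conj_op U P | P <- F] F.
Proof.
move=> cU; have [phi phiI [UU _]] := clifford_acts cU.
have inj : injective (conj_op U).
  apply: (can_inj (g := fun X => U ^t* *m X *m U)) => X.
  by rewrite /conj_op !mulmxA (mulmx1C UU) mul1mx -mulmxA (mulmx1C UU) mulmx1.
have uF : uniq [seq conj_op U P | P <- F] by rewrite map_inj_uniq ?fset_uniq.
apply: uniq_perm => //; first exact: fset_uniq.
have sub : {subset [seq conj_op U P | P <- F] <= F}.
  move=> _ /mapP[P PF ->]; apply/in_ensemble/stabilizer_state_conj => //.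
  exact/in_ensemble.
by have [] := uniq_min_size uF sub; rewrite size_map.
Qed.

Definition stabilizer_groups : seq {set pauli Q} := [seq stab P | P <- F].

Lemma lagrangian_groups : {in stabilizer_groups, forall S, lagrangian S}.
Proof. by move=> _ /mapP[P /in_ensemble/stabilizer_stateP[_ lP] ->]. Qed.

Lemma pair_count_invariant U phi : clifford U -> acts_as U phi ->
  invariant (pair_count stabilizer_groups) phi.
Proof.
move=> cU Uphi u v; rewrite /pair_count !big_map -(perm_big _ (ensemble_conj cU)) big_map.
by apply: eq_bigr => P _; rewrite !(stab_conj _ _ Uphi).
Qed.

Lemma groups_transvection w : invariant (pair_count stabilizer_groups) (transvection w).
Proof.
apply: transvection_invariant => [q|q|c t ct].
- exact: pair_count_invariant (clifford_hadamard R q) (hadamard_acts R q).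
- exact: pair_count_invariant (clifford_phase R q) (phase_acts R q).
- exact: pair_count_invariant (clifford_cnot R ct) (cnot_acts R ct).
Qed.

(** A single state may be far from the target; it is enough that the error is bounded by a quantity
    of the group with bounded mean. *)
Lemma stabilizer_average_close (f : op R Q -> R) (d : R) (k : {set pauli Q} -> nat) (K : nat) :
    (forall P, stabilizer_states P -> `|f P - d| <= (k (stab P))%:R) ->
    (\sum_(S <- stabilizer_groups) k S <= K * size stabilizer_groups)%N ->
  `|stabilizer_average f - d| <= K%:R.
Proof.
move=> fd kK; rewrite /stabilizer_average.
have F0 : 0 < #|` F|%:R :> R by rewrite ltr0n ensemble_gt0.
have -> : (\sum_(P <- F) f P) / #|` F|%:R - d = (\sum_(P <- F) (f P - d)) / #|` F|%:R.
  rewrite sumrB mulrBl; congr (_ - _).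
  by rewrite big_const_seq count_predT iter_addr_0 -(mulr_natr d) mulfK ?lt0r_neq0.
rewrite normrM [X in _ * X]gtr0_norm ?invr_gt0 // ler_pdivrMr //.
apply: le_trans (ler_norm_sum _ _ _) _.
apply: (@le_trans _ _ (\sum_(P <- F) (k (stab P))%:R)).
  by rewrite ![\sum_(_ <- F) _]big_seq; apply: ler_sum => P /in_ensemble/fd.
move: kK; rewrite -(ler_nat R) size_map natrM big_map => /(le_trans _); apply.
by rewrite natr_sum.
Qed.

Lemma eq_stabilizer_average (f g : op R Q -> R) :
  (forall P, stabilizer_states P -> f P = g P) -> stabilizer_average f = stabilizer_average g.
Proof.
move=> fg; congr (_ / _); rewrite big_seq [RHS]big_seq.
by apply: eq_bigr => P /in_ensemble/fg.
Qed.

End Ensemble.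

(** * Averaged negativity up to a bounded error *)

Lemma card_tripartition_setU (Q : finType) (A B C : {set Q}) :
  tripartition A B C -> (#|A :|: B| = #|A| + #|B|)%N.
Proof.
move=> p3; have := card_tripartition p3; have := cardsC C.
by rewrite (tripartition_setC p3) => <-; lia.
Qed.

(** Write a, b, c for the sizes of S_A, S_BC, S_C. Then z <= a b, and duality gives a 4^|B| 4^|C| =
    2^n b and |S_AB| 4^|C| = 2^n c with c >= 1. The bound is stated for any [z] below the triple
    count so that it also applies with A and B exchanged, where [radical] is written with the other
    region. *)
Lemma radical_ratio (Q : finType) (S : {set pauli Q}) (A B C : {set Q}) z :
    lagrangian S -> tripartition A B C -> (z <= #|triples S A B C|)%N ->
  (4 ^ #|B| * z <= #|local S (B :|: C)| ^ 2 * #|local S (A :|: B)|)%N.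
Proof.
move=> lagS p3 zT.
have p3' := tripartition_rot p3.
have := card_local_setC lagS (B :|: C).
have -> : ~: (B :|: C) = A by rewrite (tripartition_setC p3') finset.setCK.
rewrite (card_tripartition_setU p3') expnD => eA.
have := card_local_setC lagS C; rewrite -(tripartition_setC p3) => eC.
have zab := leq_trans zT (card_triples_le lagS p3).
have c0 := local_gt0 lagS C.
have C4 : (0 < 4 ^ #|C|)%N by rewrite expn_gt0.
have B4 : (0 < 4 ^ #|B|)%N by rewrite expn_gt0.
rewrite -(leq_pmul2r C4) -[leqRHS]mulnA eC.
move: zab c0 eA {eC}; move: #|local S A| #|local S (B :|: C)| #|local S C| => a b c.
move: (4 ^ #|C|)%N (4 ^ #|B|)%N (2 ^ _)%N C4 B4 => x y N x0 y0 zab c0 e.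
have h : (y * z * x <= y * (a * b) * x)%N by rewrite leq_pmul2r // leq_pmul2l.
apply: leq_trans h _.
have -> : (y * (a * b) * x = N * b * b)%N by rewrite -e; ring.
rewrite (_ : b ^ 2 * (N * c) = N * b * b * c)%N; last by ring.
by rewrite leq_pmulr.
Qed.

Section Bounds.
Variables (R : realType) (nA nB nC : nat).
Local Notation Q := (qubitsABC nA nB nC).
Local Notation rA := (regionA 'I_nA 'I_nB 'I_nC).
Local Notation rB := (regionB 'I_nA 'I_nB 'I_nC).
Local Notation rC := (regionC 'I_nA 'I_nB 'I_nC).
Local Notation p3 := (@regions_tripartition 'I_nA 'I_nB 'I_nC).
Local Notation L := (stabilizer_groups R Q).
Local Notation avg := (average_log_negativity R nA nB nC).
Local Notation G S := #|local S (rA :|: rB)|.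
Local Notation Z S := #|radical S rA rB|.

Lemma card_qubits : #|Q| = (nA + nB + nC)%N.
Proof. by rewrite !card_sum !card_ord. Qed.

Lemma average_negativities : avg = average_negativity3 R nA nB nC.
Proof.
apply: eq_stabilizer_average => P /stabilizer_stateP[pP lP].
exact: log_negativity_stabilizer.
Qed.

Lemma log_negativityE P : stabilizer_states P ->
  log_negativity (partial_trace P) =
    (ln (G (stab P))%:R - ln (Z (stab P))%:R) / 2%:R :> R.
Proof.
move=> /stabilizer_stateP[pP lP].
rewrite log_negativity_stabilizer // negativity3_stabilizer // ln_div //.
  by rewrite posrE ltr0n local_gt0.
by rewrite posrE ltr0n (radical_gt0 lP).
Qed.

Lemma ln_nat_bounds (k : nat) : (0 < k)%N -> 0 <= ln (k%:R : R) <= k%:R.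
Proof.
move=> k0; rewrite ln_ge0 ?ler1n //=.
by apply/ltW/ln_sublinear; rewrite ltr0n.
Qed.

Lemma ln_natM (k l : nat) : (0 < k)%N -> (0 < l)%N -> ln (k * l)%:R = ln k%:R + ln l%:R :> R.
Proof. by move=> k0 l0; rewrite natrM lnM // posrE ltr0n. Qed.

Lemma ln_natX (k l : nat) : (0 < k)%N -> ln (k ^ l)%:R = l%:R * ln k%:R :> R.
Proof. by move=> k0; rewrite natrX lnXn ?ltr0n // mulr_natl. Qed.

Lemma ln_nat_le (k l : nat) : (0 < k)%N -> (k <= l)%N -> ln (k%:R : R) <= ln l%:R.
Proof.
by move=> k0 kl; rewrite ler_ln ?posrE ?ltr0n ?ler_nat //; apply: leq_trans kl.
Qed.

Lemma ln4 : ln 4%:R = 2 * ln 2 :> R.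
Proof. by rewrite -(ln_natX 2). Qed.

Let lagL := @lagrangian_groups R Q.
Let transL := @groups_transvection R Q.

(** Since 1 <= |Z| <= |G|, the negativity lies between 0 and |G|; as AB is at most half of the
    qubits, |G| averages to at most 2. *)
Lemma average_negativity_small : (nA + nB <= nC)%N -> `|avg - 0| <= 2%:R.
Proof.
move=> small.
apply: (stabilizer_average_close (k := fun S => G S)); last first.
  rewrite mul2n; apply: (sum_local lagL transL).
  rewrite (card_tripartition_setU p3) card_regionA card_regionB card_qubits !card_ord; lia.
move=> P sP; rewrite log_negativityE // subr0; have [_ lP] := stabilizer_stateP sP.
have G0 := local_gt0 lP (rA :|: rB); have Z0 := radical_gt0 lP rA rB.
have := ln_nat_bounds G0; have := ln_nat_bounds Z0.
have := ln_nat_le Z0 (subset_leq_card (radical_sub _ rA rB)).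
by move=> h1 /andP[h2 h3] /andP[h4 h5]; rewrite ger0_norm; lra.
Qed.

(** Duality gives ln |G| = (n_A + n_B - n_C) ln 2 + ln |S_C|, so the deviation is (ln |S_C| - ln
    |Z|) / 2. The constant 12 is 2 for the mean of |S_C| plus 10 for that of [triples]. *)
Lemma average_negativity_balanced :
    (2 <= nA + nB + nC)%N -> (nA <= nB + nC)%N -> (nB <= nA + nC)%N -> (nC <= nA + nB)%N ->
  `|avg - ((nA + nB)%:R - nC%:R) / 2%:R * ln 2%:R| <= 12%:R.
Proof.
move=> n2 hA hB hC.
apply: (stabilizer_average_close (k := fun S => (#|local S rC| + #|triples S rA rB rC|)%N)).
  move=> P sP; rewrite log_negativityE //; have [_ lP] := stabilizer_stateP sP.
  have G0 := local_gt0 lP (rA :|: rB); have Z0 := radical_gt0 lP rA rB.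
  have C0 := local_gt0 lP rC.
  have := ln_nat_bounds C0; have := ln_nat_bounds Z0.
  have := card_local_setC lP rC; rewrite -(tripartition_setC p3).
  move/(congr1 (fun k : nat => ln k%:R : R)).
  rewrite !ln_natM ?expn_gt0 // !ln_natX // card_qubits card_regionC card_ord ln4.
  have := radical_le_triples lP p3; rewrite -(ler_nat R) natrD.
  rewrite !natrD => zT e /andP[h1 h2] /andP[h3 h4].
  rewrite ler_norml; apply/andP; split; lra.
rewrite big_split /= (_ : 12 = 2 + 10)%N // mulnDl mul2n.
have half (X : {set Q}) : (#|X|.*2 <= #|Q|)%N -> (\sum_(S <- L) #|local S X| <= (size L).*2)%N.
  exact: (sum_local lagL transL).
have sA : (#|rA|.*2 <= #|Q|)%N by rewrite card_regionA card_qubits card_ord; lia.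
have sB : (#|rB|.*2 <= #|Q|)%N by rewrite card_regionB card_qubits card_ord; lia.
have sC : (#|rC|.*2 <= #|Q|)%N by rewrite card_regionC card_qubits card_ord; lia.
rewrite leq_add ?half //.
have Q2 : (2 <= #|Q|)%N by rewrite card_qubits.
apply: leq_trans (sum_triples lagL transL Q2 p3) _.
rewrite !big_split /= (_ : 10 = 2 + 2 + 2 + 4)%N // !mulnDl leq_add2r mul2n.
by rewrite !leq_add ?half.
Qed.

(** From |G| <= 4^n_B |Z| <= |S_BC|^2 |G|, each state is within ln |S_BC| of n_B ln 2. B and C fill
    at most half of the qubits, so |S_BC| averages to at most 2. *)
Lemma average_negativity_large_l : (nB + nC <= nA)%N ->
  `|avg - nB%:R * ln 2%:R| <= 2%:R.
Proof.
move=> large.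
apply: (stabilizer_average_close (k := fun S => #|local S (rB :|: rC)|)); last first.
  rewrite mul2n; apply: (sum_local lagL transL).
  rewrite (card_tripartition_setU (tripartition_rot p3)) card_regionC card_regionB card_qubits !card_ord; lia.
move=> P sP; rewrite log_negativityE //; have [_ lP] := stabilizer_stateP sP.
have G0 := local_gt0 lP (rA :|: rB); have Z0 := radical_gt0 lP rA rB.
have BC0 := local_gt0 lP (rB :|: rC).
have pos : (0 < 4 ^ #|rB| * Z (stab P))%N by rewrite muln_gt0 expn_gt0.
have := ln_nat_le pos (radical_ratio lP p3 (radical_le_triples lP p3)).
have := ln_nat_le G0 (card_local_le_radical_r lP rA rB).
rewrite !ln_natM ?expn_gt0 ?BC0 // !ln_natX // card_regionB card_ord ln4.
have /andP[h1 h2] := ln_nat_bounds BC0 => h3 h4.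
rewrite ler_norml; apply/andP; split; lra.
Qed.

Lemma average_negativity_large_r : (nA + nC <= nB)%N ->
  `|avg - nA%:R * ln 2%:R| <= 2%:R.
Proof.
move=> large.
apply: (stabilizer_average_close (k := fun S => #|local S (rA :|: rC)|)); last first.
  rewrite mul2n; apply: (sum_local lagL transL).
  rewrite (card_tripartition_setU (tripartition_rot (tripartition_swap p3))).
  rewrite card_regionC card_regionA card_qubits !card_ord; lia.
move=> P sP; rewrite log_negativityE //; have [_ lP] := stabilizer_stateP sP.
have G0 := local_gt0 lP (rA :|: rB); have Z0 := radical_gt0 lP rA rB.
have AC0 := local_gt0 lP (rA :|: rC).
have zT := radical_le_triples lP p3; rewrite (triples_swap lP p3) in zT.
have pos : (0 < 4 ^ #|rA| * Z (stab P))%N by rewrite muln_gt0 expn_gt0.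
have := ln_nat_le pos (radical_ratio lP (tripartition_swap p3) zT).
rewrite (finset.setUC rB rA).
have := ln_nat_le G0 (card_local_le_radical_l lP rA rB).
rewrite !ln_natM ?expn_gt0 ?AC0 // !ln_natX // card_regionA card_ord ln4.
have /andP[h1 h2] := ln_nat_bounds AC0 => h3 h4.
rewrite ler_norml; apply/andP; split; lra.
Qed.

End Bounds.

(** * Leading order *)

Lemma leading_order_bounded (R : realType) (n : nat -> nat) (f g : nat -> R) (K : R) :
    n k @[k --> \oo] --> \oo ->
    (\forall k \near \oo, `|f k - g k| <= K) ->
  leading_order_eq n f g.
Proof.
move=> /cvgnyPge n_oo fg; apply/cvgr0Pnorm_le => e e0.
near=> k.
have nk : (Num.trunc (K / e)).+1%:R <= (n k)%:R :> R.
  by rewrite ler_nat; near: k; apply: n_oo.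
have nk0 : 0 < (n k)%:R :> R by apply: lt_le_trans nk; rewrite ltr0n.
rewrite normrM normfV (gtr0_norm nk0) ler_pdivrMr //.
have fgK : `|f k - g k| <= K by near: k.
apply: le_trans fgK _; rewrite -ler_pdivrMl // mulrC.
by apply: le_trans nk; apply/ltW/truncnS_gt.
Unshelve. all: by end_near.
Qed.

Theorem mainTheorem13 (R : realType) (nA nB nC n : nat -> nat) (fA fB fC : R)
    (hn : forall k, n k = (nA k + nB k + nC k)%N)
    (hlim : n k @[k --> \oo] --> \oo)
    (hA : (nA k)%:R / (n k)%:R @[k --> \oo] --> fA)
    (hB : (nB k)%:R / (n k)%:R @[k --> \oo] --> fB)
    (hC : (nC k)%:R / (n k)%:R @[k --> \oo] --> fC) :
  [/\ (fC > fA + fB ->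
        (forall k, average_log_negativity R (nA k) (nB k) (nC k)
                   = average_negativity3 R (nA k) (nB k) (nC k)) /\
        leading_order_eq n
          (fun k => average_log_negativity R (nA k) (nB k) (nC k))
          (fun k => 0)),
      (fC < fA + fB -> fA < 1 / 2%:R -> fB < 1 / 2%:R ->
        (forall k, average_log_negativity R (nA k) (nB k) (nC k)
                   = average_negativity3 R (nA k) (nB k) (nC k)) /\
        leading_order_eq n
          (fun k => average_log_negativity R (nA k) (nB k) (nC k))
          (fun k => ((nA k + nB k)%:R - (nC k)%:R) / 2%:R * ln 2%:R)) &
      (fC < fA + fB -> fA > 1 / 2%:R \/ fB > 1 / 2%:R ->
        (forall k, average_log_negativity R (nA k) (nB k) (nC k)
                   = average_negativity3 R (nA k) (nB k) (nC k)) /\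
        leading_order_eq n
          (fun k => average_log_negativity R (nA k) (nB k) (nC k))
          (fun k => (minn (nA k) (nB k))%:R * ln 2%:R))].
Proof.
(* Two qubits rather than one: besides positivity of the denominators, this supplies the size
   hypothesis of the pair-counting bound. *)
have n_gt0 : \forall k \near \oo, (1 < n k)%N by move/cvgnyPge: hlim; apply.
have hAB : ((nA k)%:R / (n k)%:R + (nB k)%:R / (n k)%:R) @[k --> \oo] --> fA + fB by exact: cvgD.
have hABC : ((nC k)%:R / (n k)%:R - ((nA k)%:R / (n k)%:R + (nB k)%:R / (n k)%:R))
    @[k --> \oo] --> fC - (fA + fB) by exact: cvgB.
(* Strict inequalities between limit fractions become eventual inequalities between integers, the
   form required by the bounds at fixed sizes. *)
have half (x : nat -> nat) (f : R) : (x k)%:R / (n k)%:R @[k --> \oo] --> f ->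
    (f < 1 / 2%:R -> \forall k \near \oo, ((x k).*2 < n k)%N) /\
    (1 / 2%:R < f -> \forall k \near \oo, (n k < (x k).*2)%N).
  move=> xf; split=> f2.
    have near_f : \forall k \near \oo, (x k)%:R / (n k)%:R < 1 / 2%:R :> R.
      exact: (cvgr_lt _ xf).
    near=> k; have nk : (1 < n k)%N by near: k.
    have : (x k)%:R / (n k)%:R < 1 / 2%:R :> R by near: k.
    rewrite ltr_pdivrMr ?ltr0n ?(ltnW nk) // mulrAC ltr_pdivlMr ?ltr0n //.
    by rewrite mul1r -natrM ltr_nat muln2.
  have near_f : \forall k \near \oo, 1 / 2%:R < (x k)%:R / (n k)%:R :> R.
    exact: (cvgr_gt _ xf).
  near=> k; have nk : (1 < n k)%N by near: k.
  have : 1 / 2%:R < (x k)%:R / (n k)%:R :> R by near: k.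
  rewrite ltr_pdivlMr ?ltr0n ?(ltnW nk) // mulrAC ltr_pdivrMr ?ltr0n //.
  by rewrite mul1r -natrM ltr_nat muln2.
have [A_lt A_gt] := half _ _ hA; have [B_lt B_gt] := half _ _ hB.
split.
- move=> fCAB; split=> [k|]; first exact: average_negativities.
  have near_f : \forall k \near \oo, 0 <
      (nC k)%:R / (n k)%:R - ((nA k)%:R / (n k)%:R + (nB k)%:R / (n k)%:R) :> R.
    by apply: (cvgr_gt _ hABC); rewrite subr_gt0.
  apply: (leading_order_bounded (K := 2%:R)) => //; near=> k.
  apply: average_negativity_small.
  have : 0 < (nC k)%:R / (n k)%:R - ((nA k)%:R / (n k)%:R + (nB k)%:R / (n k)%:R) :> R by near: k.
  have nk : (1 < n k)%N by near: k.
  rewrite subr_gt0 -mulrDl ltr_pM2r ?invr_gt0 ?ltr0n ?(ltnW nk) // -natrD ltr_nat.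
  exact: ltnW.
- move=> fCAB fA2 fB2; split=> [k|]; first exact: average_negativities.
  have near_f : \forall k \near \oo,
      (nC k)%:R / (n k)%:R - ((nA k)%:R / (n k)%:R + (nB k)%:R / (n k)%:R) < 0 :> R.
    by apply: (cvgr_lt _ hABC); rewrite subr_lt0.
  apply: (leading_order_bounded (K := 12%:R)) => //; near=> k.
  have nk : (1 < n k)%N by near: k.
  have Ak : ((nA k).*2 < n k)%N by near: k; apply: A_lt.
  have Bk : ((nB k).*2 < n k)%N by near: k; apply: B_lt.
  have : (nC k)%:R / (n k)%:R - ((nA k)%:R / (n k)%:R + (nB k)%:R / (n k)%:R) < 0 :> R by near: k.
  rewrite subr_lt0 -mulrDl ltr_pM2r ?invr_gt0 ?ltr0n ?(ltnW nk) // -natrD ltr_nat => Ck.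
  by move: nk Ak Bk; rewrite hn => nk Ak Bk; apply: average_negativity_balanced; lia.
move=> _ large; split=> [k|]; first exact: average_negativities.
apply: (leading_order_bounded (K := 2%:R)) => //; case: large => [/A_gt|/B_gt] large; near=> k.
  have : (n k < (nA k).*2)%N by near: k.
  rewrite hn => Ak; rewrite (minn_idPr _); last by lia.
  by apply: average_negativity_large_l; lia.
have : (n k < (nB k).*2)%N by near: k.
rewrite hn => Bk; rewrite (minn_idPl _); last by lia.
by apply: average_negativity_large_r; lia.
Unshelve. all: by end_near.
Qed.
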